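(* Let $\lambda,\mu,\nu$ be partitions with $\mu_i\le\lambda_i$ for all $i$, such that the skew diagram $\lambda/\mu$ is connected. Then, in the algebra $\Lambda$ of symmetric functions in infinitely many variables $x_1,x_2,\dots$, $$s_{\lambda/\mu}=s_\nu \quad\text{if and only if}\quad \lambda/\mu=\nu \ \text{ or } \ \lambda/\mu=\nu^\circ,$$ where equality of diagrams means equality of the arrays of boxes up to translation.
   Context: For a partition $\lambda=\lambda_1\ge\dots\ge\lambda_k>0$, the (Ferrers) diagram of $\lambda$ is the left-justified array of boxes with $\lambda_i$ boxes in row $i$ (rows numbered top to bottom). For partitions $\mu\subseteq\lambda$ (i.e. $\mu_i\le\lambda_i$ for all $i$), the skew diagram $\lambda/\mu$ is the set of boxes of the diagram of $\lambda$ not in the diagram of $\mu$. It is connected if any two adjacent nonempty rows share at least one column in which both have a box. A semi-standard skew tableau of shape $\lambda/\mu$ is a filling of its boxes with positive integers weakly increasing along rows and strictly increasing down columns; the skew Schur function is $s_{\lambda/\mu}=\sum_T x^T$ over all such $T$, where $x^T=\prod_i x_i^{t_i}$ and $t_i$ is the number of entries equal to $i$ in $T$; $s_\nu=s_{\nu/\emptyset}$. For a diagram $\nu$, $\nu^\circ$ denotes the skew diagram obtained by rotating the diagram of $\nu$ by $180^\circ$. *)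

(* Defs.v *)
From mathcomp Require Import all_boot all_order all_algebra.
Set Implicit Arguments. Unset Strict Implicit. Unset Printing Implicit Defensive.

Definition is_partition (la : seq nat) : bool :=
  sorted geq la && all (fun x => 0 < x) la.

Definition in_skew (la mu : seq nat) (i j : nat) : bool :=
  (nth 0 mu i <= j) && (j < nth 0 la i).

Definition row_nonempty (la mu : seq nat) (i : nat) : bool :=
  nth 0 mu i < nth 0 la i.

Definition skew_connected (la mu : seq nat) : Prop :=
  forall i j, i < j -> row_nonempty la mu i -> row_nonempty la mu j ->
    (forall k, i < k < j -> ~~ row_nonempty la mu k) ->
    exists c, in_skew la mu i c && in_skew la mu j c.

(* Semistandard skew tableaux of shape la/mu, encoded as finite functions on
   the bounding box 'I_(size la) x 'I_(head 0 la), equal to 0 outside the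
   diagram and with values in {1, ..., n} on the diagram. *)
Notation box la := ('I_(size la) * 'I_(head 0 la))%type.

Definition is_ssyt (la mu : seq nat) (n : nat)
    (T : {ffun 'I_(size la) * 'I_(head 0 la) -> 'I_n.+1}) : bool :=
  [forall b : box la, ~~ in_skew la mu b.1 b.2 ==> (val (T b) == 0)] &&
  [forall b : box la, in_skew la mu b.1 b.2 ==> (0 < val (T b))] &&
  [forall b : box la, forall b' : box la, [&& in_skew la mu b.1 b.2, in_skew la mu b'.1 b'.2,
      val b.1 == val b'.1 & val b.2 < val b'.2] ==> (val (T b) <= val (T b'))] &&
  [forall b : box la, forall b' : box la, [&& in_skew la mu b.1 b.2, in_skew la mu b'.1 b'.2,
      val b.2 == val b'.2 & val b.1 < val b'.1] ==> (val (T b) < val (T b'))].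

(* Coefficient of the monomial x_1^(a_1) ... x_n^(a_n) (a = [:: a_1; ...; a_n])
   in the skew Schur function s_{la/mu}: the number of semistandard skew
   tableaux T of shape la/mu with t_k = a_k for all k (and hence no entry > n). *)
Definition skew_schur_coef (la mu : seq nat) (a : seq nat) : nat :=
  #|[set T : {ffun 'I_(size la) * 'I_(head 0 la) -> 'I_(size a).+1} |
      @is_ssyt la mu (size a) T &&
      [forall k : 'I_(size a),
         #|[set b : box la | in_skew la mu b.1 b.2 & val (T b) == k.+1]| == nth 0 a k]]|.

Definition skew_schur_eq (la mu la' mu' : seq nat) : Prop :=
  forall a : seq nat, skew_schur_coef la mu a = skew_schur_coef la' mu' a.

Definition in_skewZ (la mu : seq nat) (i j : int) : bool :=
  match i, j with
  | Posz i', Posz j' => in_skew la mu i' j'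
  | _, _ => false
  end.

Definition skew_eq_shape (la mu nu : seq nat) : Prop :=
  exists a b : int, forall i j : int,
    in_skewZ la mu i j = in_skewZ nu [::] (i - a)%R (j - b)%R.

Definition skew_eq_rot_shape (la mu nu : seq nat) : Prop :=
  exists a b : int, forall i j : int,
    in_skewZ la mu i j = in_skewZ nu [::] (a - i)%R (b - j)%R.

(* Main.v *)
Require Import Defs.
From mathcomp Require Import all_boot all_order all_algebra.
From mathcomp Require Import zify.

Set Implicit Arguments. Unset Strict Implicit. Unset Printing Implicit Defensive.

(** Rotating a tableau and complementing its entries reverses the content, and
Schur functions are symmetric (Bender-Knuth); this gives one direction.

For the converse, the dominance-largest content of a tableau of shape la/mu is
that of the filling of each column by 1, 2, ..., so s_{la/mu} = s_nu forces the
multiset of column lengths of la/mu to be that of nu. Let p <= q be column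
lengths with no column length strictly between them. There are at most q-p+1
tableaux of shape nu whose content is nu with one p replaced by q+1. In la/mu
take columns x, y of lengths p, q sharing neither their top row nor their bottom
row, each the rightmost one occupying its rows. For each k in [p, q+1], replacing
the bottom entry of x by k and filling y with {1, ..., q+1} \ {k} (so with
{1, ..., q} if k = q+1) gives a tableau of that content, one too many. Hence any
two such columns share their top or their bottom row, and as tops and bottoms are
both monotone along columns, either all tops or all bottoms agree. *)

(** * Column lengths and cells of skew diagrams *)

Definition conj_part (s : seq nat) (j : nat) : nat := count (ltn j) s.

Lemma partition_nth_anti s i j : is_partition s -> i <= j -> nth 0 s j <= nth 0 s i.
Proof.
case/andP=> s_sorted _ le_ij; have [lt_js|] := ltnP j (size s); last first.
  by move=> /(nth_default 0) ->.
apply: (sorted_leq_nth (leT := geq)) => //; rewrite ?inE ?(leq_ltn_trans le_ij) //.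
  by move=> ? ? ? /= h1 h2; apply: leq_trans h1.
by move=> ?; apply: leqnn.
Qed.

Lemma conj_partP s i j : is_partition s -> (i < conj_part s j) = (j < nth 0 s i).
Proof.
move=> /andP[+ _]; rewrite /conj_part; elim: s i => [|x s IH] i s_sorted /=.
  by rewrite nth_nil.
have tail_sorted := path_sorted s_sorted.
have [lt_jx|le_xj] := ltnP j x; first by case: i => [|i] //=; rewrite ltnS IH.
have tail_le y : y \in s -> y <= x.
  have geq_trans : transitive geq by move=> ? ? ? /= h1 h2; apply: leq_trans h1.
  by move: s_sorted => /= /(order_path_min geq_trans) /allP; apply.
have -> : count (ltn j) s = 0.
  by apply/eqP; rewrite -leqn0 leqNgt -has_count; apply/hasPn => y /tail_le /= ?; lia.
rewrite addn0; case: i => [|i] /=; first by rewrite ltnn [RHS]ltnNge le_xj.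
rewrite ltn0; apply/esym/negbTE; rewrite -leqNgt.
have [lt_is|/(nth_default 0) ->] := ltnP i (size s); last by [].
by apply: leq_trans le_xj; apply: tail_le; apply: mem_nth.
Qed.

Lemma conj_part_anti s i j : i <= j -> conj_part s j <= conj_part s i.
Proof. by move=> le_ij; apply: sub_count => x /=; apply: leq_ltn_trans. Qed.

Lemma in_skew_conj la mu i j : is_partition la -> is_partition mu ->
  in_skew la mu i j = (conj_part mu j <= i < conj_part la j).
Proof. by move=> la_part mu_part; rewrite conj_partP // leqNgt conj_partP // -leqNgt. Qed.

Lemma in_skew_nil nu i j : in_skew nu [::] i j = (j < nth 0 nu i).
Proof. by rewrite /in_skew nth_nil. Qed.

Lemma in_skew_bound la mu i j : is_partition la -> in_skew la mu i j ->
  (i < size la) && (j < head 0 la).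
Proof.
move=> la_part /andP[_ lt_j]; apply/andP; split.
  by rewrite ltnNge; apply/negP => /(nth_default 0) E; rewrite E in lt_j.
by rewrite -nth0; apply: leq_trans lt_j (partition_nth_anti la_part _).
Qed.

Definition cells la mu : seq (nat * nat) :=
  [seq c <- [seq (i, j) | i <- iota 0 (size la), j <- iota 0 (head 0 la)]
         | in_skew la mu c.1 c.2].

Lemma cells_uniq la mu : uniq (cells la mu).
Proof. by apply: filter_uniq; apply: allpairs_uniq => [||[? ?] [? ?]]; rewrite ?iota_uniq. Qed.

Lemma mem_cells la mu c : is_partition la -> (c \in cells la mu) = in_skew la mu c.1 c.2.
Proof.
move=> la_part; rewrite mem_filter; case: c => i j /=.
case c_in: (in_skew la mu i j) => //=.
have /andP[lt_i lt_j] := in_skew_bound la_part c_in.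
by apply/allpairsP; exists (i, j); rewrite !mem_iota.
Qed.

(** * Tableaux as functions of two natural numbers *)

Definition content la mu (f : nat -> nat -> nat) e : nat :=
  count (fun c => f c.1 c.2 == e) (cells la mu).

(** Values outside the diagram are left free, so tableaux are compared by [agree] and not by
    equality. *)
Definition tableau la mu (a : seq nat) (f : nat -> nat -> nat) : Prop :=
  [/\ forall i j, in_skew la mu i j -> 0 < f i j <= size a,
      forall i j j', in_skew la mu i j -> in_skew la mu i j' -> j < j' -> f i j <= f i j',
      forall i i' j, in_skew la mu i j -> in_skew la mu i' j -> i < i' -> f i j < f i' j
    & forall k, k < size a -> content la mu f k.+1 = nth 0 a k].

Definition agree la mu (f g : nat -> nat -> nat) : Prop :=
  forall i j, in_skew la mu i j -> f i j = g i j.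

Section Encoding.

Variables (la mu : seq nat) (a : seq nat).
Hypothesis la_part : is_partition la.

Let ffilling := {ffun 'I_(size la) * 'I_(head 0 la) -> 'I_(size a).+1}.

Let ssyts : {set ffilling} := [set T : ffilling | @is_ssyt la mu (size a) T &&
  [forall k : 'I_(size a),
    #|[set b : box la | in_skew la mu b.1 b.2 & val (T b) == k.+1]| == nth 0 a k]].

Definition filling (T : ffilling) i j : nat :=
  if insub i is Some i' then if insub j is Some j' then T (i', j') else 0 else 0.

Definition ffun_filling (f : nat -> nat -> nat) : ffilling :=
  [ffun b : box la => inord (if in_skew la mu b.1 b.2 then f b.1 b.2 else 0)].

Lemma filling_val (T : ffilling) b : filling T (val b.1) (val b.2) = T b.
Proof. by rewrite /filling !valK -surjective_pairing. Qed.

Lemma in_skew_box i j : in_skew la mu i j ->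
  exists b : box la, [/\ i = val b.1, j = val b.2 & in_skew la mu b.1 b.2].
Proof.
move=> c_in; have /andP[lt_i lt_j] := in_skew_bound la_part c_in.
by exists (Ordinal lt_i, Ordinal lt_j).
Qed.

Lemma card_content (f : nat -> nat -> nat) (T : ffilling) e :
  (forall b : box la, in_skew la mu b.1 b.2 -> val (T b) = f b.1 b.2) ->
  #|[set b : box la | in_skew la mu (val b.1) (val b.2) & val (T b) == e]| = content la mu f e.
Proof.
move=> Tf; rewrite cardE /content -size_filter.
rewrite -(size_map (fun b : box la => (val b.1, val b.2))).
apply: perm_size; apply: uniq_perm.
- by rewrite map_inj_uniq ?enum_uniq // => -[i j] [i' j'] /= [/val_inj -> /val_inj ->].
- by rewrite filter_uniq ?cells_uniq.
move=> [i j]; rewrite mem_filter mem_cells //=; apply/mapP/andP.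
  case=> b; rewrite mem_enum inE => /andP[b_in /eqP Tb] [-> ->].
  by rewrite -(Tf _ b_in); split; first apply/eqP.
case=> /eqP fe /in_skew_box[b [Ei Ej b_in]]; exists b; last by rewrite Ei Ej.
by rewrite mem_enum inE b_in Tf // -Ei -Ej fe eqxx.
Qed.

Lemma tableau_filling T : T \in ssyts -> tableau la mu a (filling T).
Proof.
rewrite inE => /andP[/andP[/andP[/andP[_ Tpos] Trow] Tcol] Tcont].
split.
- move=> i j /in_skew_box[b [-> -> b_in]]; rewrite filling_val.
  by have /forallP/(_ b) := Tpos; rewrite b_in /= => ->; rewrite -ltnS ltn_ord.
- move=> i j j' /in_skew_box[b [-> -> b_in]] /in_skew_box[b' [E -> b'_in]] lt_j.
  rewrite {2}E !filling_val.
  have /forallP/(_ b)/forallP/(_ b') := Trow.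
  by rewrite b_in b'_in lt_j E eqxx.
- move=> i i' j /in_skew_box[b [-> -> b_in]] /in_skew_box[b' [-> E b'_in]] lt_i.
  rewrite {2}E !filling_val.
  have /forallP/(_ b)/forallP/(_ b') := Tcol.
  by rewrite b_in b'_in lt_i E eqxx.
move=> k lt_k; have /forallP/(_ (Ordinal lt_k))/eqP /= <- := Tcont.
by apply/esym/card_content => b _; rewrite filling_val.
Qed.

Lemma filling_inj T T' : T \in ssyts -> T' \in ssyts ->
  agree la mu (filling T) (filling T') -> T = T'.
Proof.
rewrite !inE => /andP[/andP[/andP[/andP[T0 _] _] _] _].
move=> /andP[/andP[/andP[/andP[T'0 _] _] _] _] E; apply/ffunP => b; apply: val_inj.
case b_in: (in_skew la mu b.1 b.2).
  by have := E _ _ b_in; rewrite !filling_val.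
have /forallP/(_ b) := T0; have /forallP/(_ b) := T'0.
by rewrite b_in /= => /eqP -> /eqP ->.
Qed.

Lemma val_ffun_filling f (b : box la) : tableau la mu a f ->
  val (ffun_filling f b) = if in_skew la mu b.1 b.2 then f b.1 b.2 else 0.
Proof.
case=> f_bound _ _ _; rewrite /ffun_filling ffunE /= inordK //.
by case: ifP => // /f_bound /andP[]; rewrite ltnS.
Qed.

Lemma ffun_filling_ssyt f : tableau la mu a f -> ffun_filling f \in ssyts.
Proof.
move=> f_tab; have [f_bound f_row f_col f_cont] := f_tab.
have fE := fun b : box la => val_ffun_filling b f_tab.
rewrite inE /is_ssyt -!andbA; apply/and5P; split.
- by apply/forallP => b; apply/implyP => /negbTE b_in; rewrite fE b_in.
- by apply/forallP => b; apply/implyP => b_in; rewrite fE b_in; case/andP: (f_bound _ _ b_in).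
- apply/forallP => b; apply/forallP => b'; apply/implyP => /and4P[b_in b'_in /eqP E lt_b].
  by rewrite !fE b_in b'_in; move: b_in; rewrite E => b_in; apply: f_row.
- apply/forallP => b; apply/forallP => b'; apply/implyP => /and4P[b_in b'_in /eqP E lt_b].
  by rewrite !fE b_in b'_in; move: b_in; rewrite E => b_in; apply: f_col.
- apply/forallP => k; rewrite -f_cont //; apply/eqP; apply: card_content => b b_in.
  by rewrite fE b_in.
Qed.

Lemma ffun_filling_inj f g : tableau la mu a f -> tableau la mu a g ->
  ffun_filling f = ffun_filling g -> agree la mu f g.
Proof.
move=> f_tab g_tab E i j /in_skew_box[b [-> -> b_in]].
have := val_ffun_filling b f_tab; have := val_ffun_filling b g_tab.
by rewrite b_in E => -> ->.
Qed.

(** Together with [coef_upper], [coef_tableau], [coef_gt0] and [coef_le], this is the interface by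
    which the later arguments bound coefficients without handling finite functions. *)
Lemma coef_lower m (F : nat -> nat -> nat -> nat) :
  (forall k, k < m -> tableau la mu a (F k)) ->
  (forall k k', k < m -> k' < m -> agree la mu (F k) (F k') -> k = k') ->
  m <= skew_schur_coef la mu a.
Proof.
move=> F_tab F_inj; rewrite -[X in X <= _]card_ord.
have inj : injective (fun k : 'I_m => ffun_filling (F k)).
  move=> k k' /= E; apply: val_inj; apply: (F_inj _ _ (ltn_ord k) (ltn_ord k')).
  by apply: (ffun_filling_inj _ _ E); apply: F_tab; apply: ltn_ord.
rewrite -(card_imset _ inj); apply: subset_leq_card.
by apply/subsetP => _ /imsetP[k _ ->]; apply: ffun_filling_ssyt; apply: F_tab.
Qed.

Lemma coef_upper m (G : (nat -> nat -> nat) -> nat) :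
  (forall f, tableau la mu a f -> G f < m) ->
  (forall f g, tableau la mu a f -> tableau la mu a g -> G f = G g -> agree la mu f g) ->
  skew_schur_coef la mu a <= m.
Proof.
(* The case [m = 0] is separate because [inord] needs an ordinal type of the form ['I_m.+1]. *)
case: m => [|m] G_lt G_inj.
  rewrite leqn0 cards_eq0; apply/eqP/setP => T; rewrite in_set0.
  by apply/negP => /tableau_filling/G_lt.
have inj : {in ssyts &, injective (fun T => inord (G (filling T)) : 'I_m.+1)}.
  move=> T T' TS T'S /(congr1 val) /=.
  have [f_tab g_tab] := (tableau_filling TS, tableau_filling T'S).
  rewrite !inordK ?G_lt // => /(G_inj _ _ f_tab g_tab).
  exact: filling_inj.
rewrite -[skew_schur_coef _ _ _]/#|ssyts| -(card_in_imset inj).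
by rewrite -[X in _ <= X]card_ord max_card.
Qed.

Lemma coef_tableau : 0 < skew_schur_coef la mu a -> exists f, tableau la mu a f.
Proof. by case/card_gt0P=> T TS; exists (filling T); apply: tableau_filling. Qed.

End Encoding.

Lemma coef_gt0 la mu a f : is_partition la -> tableau la mu a f ->
  0 < skew_schur_coef la mu a.
Proof.
move=> la_part f_tab; apply: (coef_lower la_part (F := fun=> f)) => //.
by case=> [|k] [|k'].
Qed.

Lemma coef_le la mu a la' mu' a' (F : (nat -> nat -> nat) -> nat -> nat -> nat) :
  is_partition la -> is_partition la' ->
  (forall f, tableau la mu a f -> tableau la' mu' a' (F f)) ->
  (forall f g, tableau la mu a f -> tableau la mu a g ->
     agree la' mu' (F f) (F g) -> agree la mu f g) ->
  skew_schur_coef la mu a <= skew_schur_coef la' mu' a'.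
Proof.
move=> la_part la'_part F_tab F_inj; rewrite /skew_schur_coef.
set S := [set T | _]; set S' := [set T | _].
pose h (T : {ffun _ -> _}) := @ffun_filling la' mu' a' (F (@filling la a T)).
have inj : {in S &, injective h}.
  move=> T T' TS T'S.
  have f_tab := tableau_filling la_part TS; have g_tab := tableau_filling la_part T'S.
  move/(ffun_filling_inj la'_part (F_tab _ f_tab) (F_tab _ g_tab)).
  by move/(F_inj _ _ f_tab g_tab); apply: filling_inj TS T'S.
rewrite -(card_in_imset inj); apply: subset_leq_card.
apply/subsetP => _ /imsetP[T TS ->]; apply: ffun_filling_ssyt => //.
by apply: F_tab; apply: tableau_filling.
Qed.

(** * Transport along an isomorphism of diagrams *)

Section Transport.

Variables (la mu la' mu' : seq nat) (r s r' s' : nat -> nat).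
Hypotheses (la_part : is_partition la) (la'_part : is_partition la').
Hypothesis toD : forall i j, in_skew la' mu' i j ->
  [/\ in_skew la mu (r i) (s j), r' (r i) = i & s' (s j) = j].
Hypothesis ofD : forall i j, in_skew la mu i j ->
  [/\ in_skew la' mu' (r' i) (s' j), r (r' i) = i & s (s' j) = j].

(** Rows and columns are moved separately, by maps that need be mutually inverse only on the cells.
    Translations and half turns both have this form. *)
Lemma cells_transport :
  perm_eq (cells la mu) [seq (r c.1, s c.2) | c <- cells la' mu'].
Proof.
apply: uniq_perm; first exact: cells_uniq.
  rewrite map_inj_in_uniq ?cells_uniq // => -[i j] [i' j'].
  rewrite !mem_cells //= => /toD[_ {2}<- {2}<-] /toD[_ {2}<- {2}<-].
  by case=> -> ->.
move=> [i j]; rewrite mem_cells //=; apply/idP/mapP.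
  move/ofD => [c_in Ei Ej]; exists (r' i, s' j); first by rewrite mem_cells.
  by rewrite /= Ei Ej.
by case=> -[i' j']; rewrite mem_cells //= => /toD[? _ _] [-> ->].
Qed.

Lemma count_transport (P : pred (nat * nat)) :
  count P (cells la mu) = count (fun c => P (r c.1, s c.2)) (cells la' mu').
Proof. by rewrite (permP cells_transport) count_map. Qed.

Lemma coef_le_shift a :
  (forall i i' j, in_skew la' mu' i j -> in_skew la' mu' i' j -> i < i' -> r i < r i') ->
  (forall i j j', in_skew la' mu' i j -> in_skew la' mu' i j' -> j < j' -> s j < s j') ->
  skew_schur_coef la mu a <= skew_schur_coef la' mu' a.
Proof.
move=> r_mono s_mono; apply: (coef_le (F := fun f i j => f (r i) (s j))) => //.
  move=> f [f_bound f_row f_col f_cont]; split.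
  - by move=> i j /toD[/f_bound].
  - move=> i j j' c_in c'_in lt_j; have lt_s := s_mono _ _ _ c_in c'_in lt_j.
    by have [[c1 _ _] [c2 _ _]] := (toD c_in, toD c'_in); apply: f_row.
  - move=> i i' j c_in c'_in lt_i; have lt_r := r_mono _ _ _ c_in c'_in lt_i.
    by have [[c1 _ _] [c2 _ _]] := (toD c_in, toD c'_in); apply: f_col.
  by move=> k /f_cont <-; rewrite /content count_transport.
by move=> f g _ _ E i j /ofD[/E /= + Er Es]; rewrite Er Es.
Qed.

(** Reversing rows and columns turns every increase into a decrease; replacing an entry [v] by
    [(size a).+1 - v] restores it and reverses the content. *)
Lemma coef_le_rotate a :
  (forall i i' j, in_skew la' mu' i j -> in_skew la' mu' i' j -> i < i' -> r i' < r i) ->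
  (forall i j j', in_skew la' mu' i j -> in_skew la' mu' i j' -> j < j' -> s j' < s j) ->
  skew_schur_coef la mu a <= skew_schur_coef la' mu' (rev a).
Proof.
move=> r_anti s_anti.
apply: (coef_le (F := fun f i j => (size a).+1 - f (r i) (s j))) => //.
  move=> f [f_bound f_row f_col f_cont]; split.
  - by move=> i j /toD[/f_bound]; rewrite size_rev; lia.
  - move=> i j j' c_in c'_in lt_j; have lt_s := s_anti _ _ _ c_in c'_in lt_j.
    have [[c1 _ _] [c2 _ _]] := (toD c_in, toD c'_in).
    by have := f_row _ _ _ c2 c1 lt_s; lia.
  - move=> i i' j c_in c'_in lt_i; have lt_r := r_anti _ _ _ c_in c'_in lt_i.
    have [[c1 _ _] [c2 _ _]] := (toD c_in, toD c'_in).
    by have := f_col _ _ _ c2 c1 lt_r; have := f_bound _ _ c1; lia.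
  move=> k; rewrite size_rev => lt_k; rewrite nth_rev // -f_cont; last by lia.
  rewrite /content count_transport; apply: eq_in_count => -[i j].
  by rewrite mem_cells //= => /toD[/f_bound]; lia.
move=> f g [f_bound _ _ _] [g_bound _ _ _] E i j c_in.
have [/E /= + Er Es] := ofD c_in; rewrite Er Es.
by have := f_bound _ _ c_in; have := g_bound _ _ c_in; lia.
Qed.

End Transport.

(** * Symmetry of Schur functions *)

(** Along a row the entries at most [e] form an initial segment; this lets the segment be recorded
    by its length alone, as in [row_leP]. *)
Lemma count_initial n (P : pred nat) j :
  (forall i j, i <= j -> j < n -> P j -> P i) -> j < n -> P j = (j < count P (iota 0 n)).
Proof.
elim: n j => // n IH j P_down lt_jn; rewrite -[in iota _ _](addn1 n) iotaD count_cat /= add0n addn0.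
have P_down' i i' : i <= i' -> i' < n -> P i' -> P i.
  by move=> le_i lt_i; apply: P_down => //; apply: ltnW.
have count_le : count P (iota 0 n) <= n by rewrite -[X in _ <= X](size_iota 0) count_size.
have [Pn|nPn] := boolP (P n).
  have -> : count P (iota 0 n) = n.
    rewrite -[RHS](size_iota 0); apply/eqP; rewrite -all_count; apply/allP => i.
    by rewrite mem_iota => /andP[_ ?]; apply: (P_down i n) => //; lia.
  by rewrite addn1 lt_jn; apply: (P_down j n) => //; lia.
rewrite addn0; have [lt_j|le_nj] := ltnP j n; first exact: IH.
have -> : j = n by lia.
by rewrite (negbTE nPn); lia.
Qed.

Lemma count_ltn_iota m n : m <= n -> count (fun j => j < m) (iota 0 n) = m.
Proof.
move=> le_mn; rewrite -(subnKC le_mn) iotaD count_cat add0n.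
rewrite (eq_in_count (a2 := predT)); last first.
  by move=> i; rewrite mem_iota.
rewrite count_predT size_iota (eq_in_count (a2 := pred0)) ?count_pred0 ?addn0 //.
by move=> i; rewrite mem_iota /= => /andP[? _]; lia.
Qed.

Lemma count_rows nu (P : pred (nat * nat)) : is_partition nu ->
  count P (cells nu [::]) =
    \sum_(0 <= i < size nu) count (fun j => P (i, j)) (iota 0 (nth 0 nu i)).
Proof.
move=> nu_part; pose rows := [seq (i, j) | i <- iota 0 (size nu), j <- iota 0 (nth 0 nu i)].
have /permP -> : perm_eq (cells nu [::]) rows.
  apply: uniq_perm; first exact: cells_uniq.
    by apply: allpairs_uniq_dep => [|i _|[i j] [i' j'] _ _ [-> ->]//]; rewrite iota_uniq.
  move=> [i j]; rewrite mem_cells //= in_skew_nil; apply/idP/allpairsPdep.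
    move=> lt_j; exists i, j; rewrite !mem_iota /= lt_j; split=> //.
    by rewrite ltnNge; apply/negP => /(nth_default 0) E; rewrite E in lt_j.
  by case=> i' [j' [_]]; rewrite mem_iota => /andP[_ lt_j] [-> ->].
rewrite /rows count_flatten sumnE !big_map /index_iota subn0.
by apply: eq_bigr => i _; rewrite count_map.
Qed.

Section BenderKnuth.

Variable nu : seq nat.
Hypothesis nu_part : is_partition nu.

(* The entries of the Gelfand-Tsetlin pattern of [f]. *)
Definition row_le (f : nat -> nat -> nat) e i :=
  count (fun j => f i j <= e) (iota 0 (nth 0 nu i)).

Lemma row_le_bound f e i : row_le f e i <= nth 0 nu i.
Proof. by rewrite -[X in _ <= X](size_iota 0) count_size. Qed.

Lemma row_le_mono f e e' i : e <= e' -> row_le f e i <= row_le f e' i.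
Proof. by move=> le_e; apply: sub_count => j /= ?; apply: leq_trans le_e. Qed.

Lemma row_leP a f e i j : tableau nu [::] a f -> j < nth 0 nu i ->
  (f i j <= e) = (j < row_le f e i).
Proof.
case=> _ f_row _ _ lt_j; apply: (count_initial (P := fun j => f i j <= e)) => // c c' le_c lt_c'.
apply: leq_trans; move: le_c; rewrite leq_eqVlt => /predU1P[->//|lt_c].
by apply: f_row => //; rewrite in_skew_nil //; apply: ltn_trans lt_c'.
Qed.

(** Column strictness in terms of thresholds: an entry at most [e.+1] in row [i.+1] has an entry at
    most [e] above it. *)
Lemma row_le_interlace a f e i : tableau nu [::] a f ->
  row_le f e.+1 i.+1 <= row_le f e i.
Proof.
move=> f_tab; case E: (row_le f e.+1 i.+1) => [|j] //.
have lt_j : j < nth 0 nu i.+1 by rewrite -E row_le_bound.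
have lt_j' : j < nth 0 nu i by apply: leq_trans lt_j (partition_nth_anti nu_part _).
rewrite -(row_leP e f_tab lt_j') -ltnS.
have : f i.+1 j <= e.+1 by rewrite (row_leP _ f_tab lt_j) E.
by apply: leq_trans; case: f_tab => _ _ f_col _; apply: f_col; rewrite ?in_skew_nil.
Qed.

(** The content is a difference of successive threshold sums, so it can be followed through a change
    of thresholds. *)
Lemma content_row_le f e :
  content nu [::] f e.+1 + \sum_(0 <= i < size nu) row_le f e i =
    \sum_(0 <= i < size nu) row_le f e.+1 i.
Proof.
rewrite /content count_rows // -big_split /=; apply: eq_bigr => i _.
rewrite /row_le addnC -count_predUI [X in _ + X](eq_count (a2 := pred0)).
  by rewrite count_pred0 addn0; apply: eq_count => j /=; lia.
by move=> j /=; lia.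
Qed.

(* Interlacing confines the [e]-th threshold of row [i] between the maximum and
   the minimum below; the Bender-Knuth involution reflects it in this interval. *)
Definition bk_row f e i : nat :=
  maxn (row_le f e.+1 i.+1) (row_le f e.-1 i)
  + (if i is i'.+1 then minn (row_le f e.+1 i) (row_le f e.-1 i') else row_le f e.+1 0)
  - row_le f e i.

Definition bender_knuth e f i j : nat :=
  if (f i j == e) || (f i j == e.+1) then (if j < bk_row f e i then e else e.+1) else f i j.

Section Entry.

Variables (a : seq nat) (f : nat -> nat -> nat) (e : nat).
Hypotheses (f_tab : tableau nu [::] a f) (e_gt0 : 0 < e).

Let u := row_le f e.-1.
Let v := row_le f e.
Let w := row_le f e.+1.

(** The first two bounds keep the new row weakly increasing; the last two are interlacing with the
    adjacent rows, hence column strictness. *)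
Lemma bk_row_bounds i :
  [/\ u i <= bk_row f e i, bk_row f e i <= w i, w i.+1 <= bk_row f e i
    & bk_row f e i.+1 <= u i].
Proof.
have uv i' : u i' <= v i' by apply: row_le_mono; lia.
have vw i' : v i' <= w i' by apply: row_le_mono; lia.
have wv i' : w i'.+1 <= v i' by apply: row_le_interlace f_tab.
have vu i' : v i'.+1 <= u i' by have := row_le_interlace e.-1 i' f_tab; rewrite prednK.
rewrite /bk_row -/u -/v -/w.
move: (uv i) (vw i) (wv i) (vu i) (uv i.+1) (vw i.+1) (wv i.+1).
by case: i => [|i]; [|move: (vu i)] => *; split; lia.
Qed.

(** The reflection written without truncated subtraction: old and new threshold add up to the sum of
    the two ends of the interval. *)
Lemma bk_row_sum i : bk_row f e i + v i =
  maxn (w i.+1) (u i) + (if i is i'.+1 then minn (w i) (u i') else w 0).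
Proof.
have uv i' : u i' <= v i' by apply: row_le_mono; lia.
have vw i' : v i' <= w i' by apply: row_le_mono; lia.
have wv i' : w i'.+1 <= v i' by apply: row_le_interlace f_tab.
have vu i' : v i'.+1 <= u i' by have := row_le_interlace e.-1 i' f_tab; rewrite prednK.
rewrite /bk_row -/u -/v -/w.
move: (uv i) (vw i) (wv i).
by case: i => [|i]; [|move: (vu i)]; lia.
Qed.

Lemma bk_row_total :
  \sum_(0 <= i < size nu) bk_row f e i + \sum_(0 <= i < size nu) v i =
  \sum_(0 <= i < size nu) u i + \sum_(0 <= i < size nu) w i.
Proof.
rewrite -!big_split /=.
rewrite (eq_bigr _ (fun i _ => bk_row_sum i)).
have w_last : w (size nu) = 0 by rewrite /w /row_le nth_default.
(* The lower end for row [i] and the upper end for row [i.+1] are the maximum and the minimum of the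
   same two numbers [w i.+1] and [u i], so they add up to the sum of these. The extra [minn]
   supplies the partner of the last maximum and vanishes at [size nu]. *)
have step n : \sum_(0 <= i < n)
    (maxn (w i.+1) (u i) + (if i is i'.+1 then minn (w i) (u i') else w 0)) + minn (w n) (if n is n'.+1 then u n' else w 0)
  = \sum_(0 <= i < n) (u i + w i) + w n.
  elim: n => [|n IH]; first by rewrite !big_geq // minnn.
  rewrite !big_nat_recr //=.
  move: IH; case: n => [|n] /=; lia.
by have := step (size nu); rewrite w_last min0n !addn0.
Qed.

Lemma bender_knuth_thresholds i j : j < nth 0 nu i ->
  bender_knuth e f i j =
    if j < u i then f i j else if j < bk_row f e i then e
    else if j < w i then e.+1 else f i j.
Proof.
move=> lt_j; rewrite /bender_knuth.
have := row_leP e.-1 f_tab lt_j; have := row_leP e.+1 f_tab lt_j; rewrite -/u -/w.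
have [] := bk_row_bounds i.
by do ![case: ifP => ?]; lia.
Qed.

Lemma row_le_bender_knuth e' i :
  row_le (bender_knuth e f) e' i = if e' == e then bk_row f e i else row_le f e' i.
Proof.
have [bk1 bk2 _ _] := bk_row_bounds i.
case: eqP => [->|ne]; last first.
  rewrite /row_le; apply: eq_in_count => j; rewrite mem_iota add0n => /andP[_ lt_j].
  by rewrite /bender_knuth; do ![case: ifP => ?]; lia.
rewrite -[RHS](@count_ltn_iota _ (nth 0 nu i)) ?(leq_trans bk2) ?row_le_bound //.
rewrite /row_le; apply: eq_in_count => j; rewrite mem_iota add0n => /andP[_ lt_j].
rewrite bender_knuth_thresholds //.
have := row_leP e.-1 f_tab lt_j; have := row_leP e.+1 f_tab lt_j; rewrite -/u -/w.
by do ![case: ifP => ?]; lia.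
Qed.

End Entry.

(** The interval of reflection depends only on the thresholds of [e.-1] and [e.+1], which are
    unchanged; hence the threshold of [e] can be recovered. *)
Lemma bender_knuth_inj a e f g : tableau nu [::] a f -> tableau nu [::] a g -> 0 < e ->
  agree nu [::] (bender_knuth e f) (bender_knuth e g) -> agree nu [::] f g.
Proof.
move=> f_tab g_tab e_gt0 E i j c_in; have lt_j : j < nth 0 nu i by rewrite -in_skew_nil.
have row_E e' i' : row_le (bender_knuth e f) e' i' = row_le (bender_knuth e g) e' i'.
  apply: eq_in_count => j'; rewrite mem_iota => /andP[_ lt_j'].
  by rewrite E ?in_skew_nil.
have row_ne e' i' : e' != e -> row_le f e' i' = row_le g e' i'.
  move=> /negbTE ne; have := row_E e' i'.
  by rewrite (row_le_bender_knuth f_tab) // (row_le_bender_knuth g_tab) // ne.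
have row_e : row_le f e i = row_le g e i.
  have := row_E e i; rewrite (row_le_bender_knuth f_tab) // (row_le_bender_knuth g_tab) // eqxx.
  have := bk_row_sum f_tab e_gt0 i; have := bk_row_sum g_tab e_gt0 i.
  have ne1 : e.-1 != e by lia.
  have ne2 : e.+1 != e by lia.
  rewrite !(row_ne e.+1) // !(row_ne e.-1) //.
  case: i {c_in lt_j} => [|i]; last rewrite (row_ne e.-1) //; lia.
have := E i j c_in.
have := row_leP e.-1 f_tab lt_j; have := row_leP e.+1 f_tab lt_j; have := row_leP e f_tab lt_j.
have := row_leP e.-1 g_tab lt_j; have := row_leP e.+1 g_tab lt_j; have := row_leP e g_tab lt_j.
rewrite row_e !(row_ne e.+1) ?(row_ne e.-1) ?neq_ltn ?ltnSn ?orbT //; last by lia.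
by rewrite /bender_knuth; do ![case: ifP => ?]; lia.
Qed.

(** Entries start at 1, so [x] counts the entries [(size s1).+1]. By [bk_row_total] the sum of the
    thresholds of [e] is reflected between those of [e.-1] and [e.+1], which exchanges the numbers
    of entries [e] and [e.+1]. *)
Lemma tableau_bender_knuth s1 x y s2 f :
  tableau nu [::] (s1 ++ x :: y :: s2) f ->
  tableau nu [::] (s1 ++ y :: x :: s2) (bender_knuth (size s1).+1 f).
Proof.
set e := (size s1).+1 => f_tab; have [f_bound f_row f_col f_cont] := f_tab.
have e_gt0 : 0 < e by [].
have bounds := bk_row_bounds f_tab e_gt0.
have thresholds := bender_knuth_thresholds f_tab e_gt0.
split.
- move=> i j /f_bound; rewrite !size_cat /= /bender_knuth.
  by do ![case: ifP => ?]; lia.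
- move=> i j j'; rewrite !in_skew_nil => lt_j lt_j' lt_jj'; rewrite !thresholds //.
  have le_f : f i j <= f i j' by apply: f_row; rewrite ?in_skew_nil.
  have := row_leP e.-1 f_tab lt_j; have := row_leP e.+1 f_tab lt_j.
  have := row_leP e.-1 f_tab lt_j'; have := row_leP e.+1 f_tab lt_j'.
  by have [] := bounds i; do ![case: ifP => ?]; lia.
- have step i j : j < nth 0 nu i -> j < nth 0 nu i.+1 ->
      bender_knuth e f i j < bender_knuth e f i.+1 j.
    move=> lt_j lt_j'; rewrite !thresholds //.
    have lt_f : f i j < f i.+1 j by apply: f_col; rewrite ?in_skew_nil.
    have := row_leP e.-1 f_tab lt_j; have := row_leP e.+1 f_tab lt_j.
    have := row_leP e.-1 f_tab lt_j'; have := row_leP e.+1 f_tab lt_j'.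
    have [] := bounds i; have [] := bounds i.+1.
    by do ![case: ifP => ?]; lia.
  move=> i i' j; rewrite !in_skew_nil => _; elim: i' => // i' IH lt_j; rewrite ltnS leq_eqVlt.
  have lt_j' : j < nth 0 nu i' by apply: leq_trans lt_j (partition_nth_anti nu_part _).
  move=> /predU1P[->|lt_i]; first exact: step.
  by apply: ltn_trans (IH lt_j' lt_i) (step _ _ lt_j' lt_j).
have total := bk_row_total f_tab e_gt0.
move=> k lt_k; have := content_row_le (bender_knuth e f) k.
have fk := content_row_le f k.
have fx := content_row_le f (size s1); have fy := content_row_le f (size s1).+1.
have sum_bk e' : \sum_(0 <= i < size nu) row_le (bender_knuth e f) e' i =
    if e' == e then \sum_(0 <= i < size nu) bk_row f e i
    else \sum_(0 <= i < size nu) row_le f e' i.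
  rewrite (eq_bigr _ (fun i _ => row_le_bender_knuth f_tab e_gt0 e' i)).
  by case: ifP.
rewrite !sum_bk.
have cx : content nu [::] f (size s1).+1 = x.
  by rewrite f_cont ?nth_cat ?ltnn ?subnn // size_cat /=; lia.
have cy : content nu [::] f (size s1).+2 = y.
  by rewrite f_cont ?nth_cat ?ltnNge ?leqnSn ?subSnn // size_cat /=; lia.
rewrite nth_cat; rewrite cx in fx; rewrite cy in fy.
have [lt_ks|] := ltnP k (size s1).
  have := f_cont k; rewrite nth_cat lt_ks size_cat /= => <-; last by lia.
  by rewrite !ifN; lia.
rewrite leq_eqVlt => /predU1P[Ek|].
  by rewrite -Ek subnn /= -/e eqxx ifN; move: total; rewrite /e /=; lia.
rewrite leq_eqVlt => /predU1P[Ek|lt_sk].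
  by rewrite -Ek subSnn /= -/e eqxx ifN; move: total; rewrite /e /=; lia.
have [d Ed] : exists d, k - size s1 = d.+2 by exists (k - size s1).-2; lia.
have nlt_k : ~~ (k < size s1) by lia.
have lt_k' : k < size (s1 ++ x :: y :: s2) by move: lt_k; rewrite !size_cat.
have := f_cont k lt_k'; rewrite nth_cat (negbTE nlt_k) Ed /= => <-.
by rewrite !ifN; lia.
Qed.

Lemma coef_swap s1 x y s2 :
  skew_schur_coef nu [::] (s1 ++ x :: y :: s2) = skew_schur_coef nu [::] (s1 ++ y :: x :: s2).
Proof.
have le x' y' : skew_schur_coef nu [::] (s1 ++ x' :: y' :: s2)
    <= skew_schur_coef nu [::] (s1 ++ y' :: x' :: s2).
  apply: (coef_le nu_part nu_part (F := bender_knuth (size s1).+1)) => [f|f g].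
    exact: tableau_bender_knuth.
  by move=> f_tab g_tab; apply: bender_knuth_inj f_tab g_tab _.
by apply/eqP; rewrite eqn_leq !le.
Qed.

(** Reversal is composed of adjacent swaps: the head is carried past the tail, which is then
    reversed by induction. This will cancel the reversal of contents under rotation. *)
Lemma coef_rev a : skew_schur_coef nu [::] (rev a) = skew_schur_coef nu [::] a.
Proof.
have move_last x s s1 s2 :
    skew_schur_coef nu [::] (s1 ++ x :: s ++ s2) = skew_schur_coef nu [::] (s1 ++ s ++ x :: s2).
  elim: s s1 => //= y s IH s1.
  by rewrite coef_swap -cat_rcons IH cat_rcons.
suff rev_mid s s1 s2 :
    skew_schur_coef nu [::] (s1 ++ rev s ++ s2) = skew_schur_coef nu [::] (s1 ++ s ++ s2).
  by have := rev_mid a [::] [::]; rewrite !cats0.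
elim: s s1 s2 => //= x s IH s1 s2.
by rewrite rev_cons cat_rcons -move_last -cat_rcons IH cat_rcons.
Qed.

End BenderKnuth.

(** * The leading monomial *)

(** For a cell of [la/mu], its position in its column, counted from 0 at the top. *)
Definition depth (mu : seq nat) (i j : nat) := i - conj_part mu j.

(** Content of the filling of each column by 1, 2, ..., indexed from 0. *)
Definition leading_coef la mu e : nat :=
  count (fun c => depth mu c.1 c.2 == e) (cells la mu).

Lemma conj_part_gt0 s j : is_partition s -> (0 < conj_part s j) = (j < head 0 s).
Proof. by move=> s_part; rewrite conj_partP // nth0. Qed.

Lemma sum_count_eq (T : Type) (s : seq T) (g : T -> nat) k :
  \sum_(0 <= e < k) count (fun c => g c == e) s = count (fun c => g c < k) s.
Proof.
elim: k => [|k IH]; first by rewrite big_geq //= (eq_count (a2 := pred0)) ?count_pred0.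
rewrite big_nat_recr //= IH -count_predUI [X in _ + X](eq_count (a2 := pred0)).
  by rewrite count_pred0 addn0; apply: eq_count => c /=; lia.
by move=> c /=; lia.
Qed.

Section SkewShape.

Variables (la mu : seq nat).
Hypotheses (la_part : is_partition la) (mu_part : is_partition mu).
Hypothesis mu_sub : forall i, nth 0 mu i <= nth 0 la i.

Let t := conj_part mu.
Let b := conj_part la.

Lemma conj_part_sub j : conj_part mu j <= conj_part la j.
Proof.
rewrite leqNgt; apply/negP; rewrite conj_partP // => /leq_trans/(_ (mu_sub _)).
by rewrite -conj_partP // ltnn.
Qed.

Lemma count_cols (P : pred (nat * nat)) :
  count P (cells la mu) =
    \sum_(0 <= j < head 0 la) count (fun d => P (t j + d, j)) (iota 0 (b j - t j)).
Proof.
pose cols := [seq (t j + d, j) | j <- iota 0 (head 0 la), d <- iota 0 (b j - t j)].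
have /permP -> : perm_eq (cells la mu) cols.
  apply: uniq_perm; first exact: cells_uniq.
    apply: allpairs_uniq_dep => [|j _|[i d] [i' d'] _ _ [+ E]]; rewrite ?iota_uniq //=.
    by move: E => /= -> /addnI ->.
  move=> [i j]; rewrite mem_cells //=; apply/idP/allpairsPdep.
    move=> c_in; exists j, (i - t j); move: (c_in); rewrite in_skew_conj // -/t -/b => ?.
    rewrite !mem_iota /= add0n.
    have /andP[_ ->] := in_skew_bound la_part c_in.
    by split; [|lia|congr (_, _); lia].
  case=> j' [d [_]]; rewrite mem_iota => /andP[_ lt_d] [-> ->].
  by rewrite in_skew_conj // -/t -/b; lia.
rewrite /cols count_flatten sumnE !big_map /index_iota subn0.
by apply: eq_bigr => i _; rewrite count_map.
Qed.

(** A column has one cell of depth [e] if it is longer than [e], and none otherwise. So these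
    numbers determine the multiset of nonzero column lengths. *)
Lemma leading_coefE e :
  leading_coef la mu e = count (fun j => e < b j - t j) (iota 0 (head 0 la)).
Proof.
rewrite /leading_coef count_cols -[RHS]sum1_count [RHS]big_mkcond /= /index_iota subn0.
apply: eq_bigr => j _; rewrite (eq_count (a2 := pred1 e)) => [|d].
  by rewrite count_uniq_mem ?iota_uniq // mem_iota /= add0n; case: ifP.
by rewrite /depth -/t addKn.
Qed.

Lemma sum_content a f k : tableau la mu a f ->
  \sum_(0 <= e < k) content la mu f e.+1 = count (fun c => f c.1 c.2 <= k) (cells la mu).
Proof.
case=> f_bound _ _ _; pose g (c : nat * nat) := (f c.1 c.2).-1.
rewrite [RHS](eq_in_count (a2 := fun c => g c < k)) => [|[i j]].
  rewrite -sum_count_eq; apply: eq_bigr => e _; apply: eq_in_count => -[i j].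
  by rewrite mem_cells // /g /= => /f_bound; lia.
by rewrite mem_cells // /g /= => /f_bound; lia.
Qed.

Lemma tableau_depth a f i j : tableau la mu a f -> in_skew la mu i j ->
  depth mu i j < f i j.
Proof.
case=> f_bound _ f_col _; rewrite /depth => c_in; move: (c_in).
rewrite in_skew_conj // => /andP[le_ti _]; rewrite -(subnKC le_ti) addKn.
have {c_in} : in_skew la mu (t j + (i - t j)) j by rewrite subnKC.
elim: (i - t j) => [|d IH] c_in; first by case/andP: (f_bound _ _ c_in).
have c'_in : in_skew la mu (t j + d) j.
  by move: c_in; rewrite !in_skew_conj // -/t -/b; lia.
by apply: leq_ltn_trans (IH c'_in) _; apply: f_col; rewrite // addnS.
Qed.

(** Rows increase weakly because the tops of the columns move weakly up to the right. *)
Lemma tableau_depth_filling n : size la <= n ->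
  tableau la mu (mkseq (leading_coef la mu) n) (fun i j => (depth mu i j).+1).
Proof.
move=> le_n; split; rewrite ?size_mkseq.
- move=> i j c_in; have := in_skew_bound la_part c_in.
  by rewrite /depth; lia.
- move=> i j j' _ _ lt_j; rewrite /depth.
  by have := conj_part_anti mu (ltnW lt_j); lia.
- move=> i i' j; rewrite !in_skew_conj // /depth; lia.
by move=> k lt_k; rewrite nth_mkseq.
Qed.

Lemma leading_coef_gt0 x p : p < b x - t x -> 0 < leading_coef la mu p.
Proof.
move=> lt_p; rewrite leading_coefE -has_count; apply/hasP; exists x => //.
by rewrite mem_iota add0n /= -conj_part_gt0 // -/b; lia.
Qed.

End SkewShape.

Lemma leading_coef_straight nu e : is_partition nu ->
  leading_coef nu [::] e = nth 0 nu e.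
Proof.
move=> nu_part; rewrite leading_coefE // -[RHS](@count_ltn_iota _ (head 0 nu)).
  by apply: eq_count => j; rewrite /conj_part subn0 -conj_partP.
by rewrite -nth0; apply: partition_nth_anti.
Qed.

(** Equality of the functions yields a tableau of shape [la'/mu'] with the leading content of
    [la/mu]. Each entry exceeds the depth of its cell, so at most as many entries are at most [k] as
    cells have depth below [k]. *)
Lemma leading_coef_dominated la mu la' mu' k :
  is_partition la -> is_partition mu -> is_partition la' -> is_partition mu' ->
  (forall i, nth 0 mu i <= nth 0 la i) ->
  skew_schur_eq la mu la' mu' ->
  \sum_(0 <= e < k) leading_coef la mu e <= \sum_(0 <= e < k) leading_coef la' mu' e.
Proof.
move=> la_part mu_part la'_part mu'_part mu_sub eq_schur.
pose a := mkseq (leading_coef la mu) (size la + k).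
have std := tableau_depth_filling la_part mu_part (leq_addr k (size la)).
have := coef_gt0 la_part std; rewrite eq_schur => /(coef_tableau la'_part)[f f_tab].
have -> : \sum_(0 <= e < k) leading_coef la mu e
        = \sum_(0 <= e < k) content la' mu' f e.+1.
  case: f_tab => _ _ _ f_cont; apply: eq_big_nat => e /andP[_ lt_e].
  by rewrite f_cont ?nth_mkseq ?size_mkseq //; lia.
rewrite (sum_content _ _ _ f_tab) // /leading_coef sum_count_eq.
rewrite -!size_filter; apply: uniq_leq_size; first exact: filter_uniq (cells_uniq _ _).
move=> [i j]; rewrite !(mem_filter _ (i, j) (cells la' mu')) => /andP[/= le_f c_in]; rewrite c_in andbT.
rewrite mem_cells // in c_in.
exact: leq_trans (tableau_depth la'_part mu'_part f_tab c_in) le_f.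
Qed.

(** Dominance in both directions makes all partial sums equal. *)
Lemma leading_coef_schur_eq la mu nu e :
  is_partition la -> is_partition mu -> is_partition nu ->
  (forall i, nth 0 mu i <= nth 0 la i) ->
  skew_schur_eq la mu nu [::] -> leading_coef la mu e = nth 0 nu e.
Proof.
move=> la_part mu_part nu_part mu_sub eq_schur; rewrite -leading_coef_straight //.
have sums k : \sum_(0 <= e < k) leading_coef la mu e
            = \sum_(0 <= e < k) leading_coef nu [::] e.
  apply/eqP; rewrite eqn_leq !leading_coef_dominated //.
  by move=> i; rewrite nth_nil.
have := sums e.+1; rewrite !big_nat_recr //= sums; lia.
Qed.

(** * Subleading monomials *)

Lemma count_le1_inj (T : eqType) (s : seq T) (P : pred T) x y :
  count P s <= 1 -> x \in s -> P x -> y \in s -> P y -> x = y.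
Proof.
move=> le1 xs Px ys Py; apply/eqP; apply/negPn/negP => ne.
have : size [:: x; y] <= size (filter P s).
  apply: uniq_leq_size; first by rewrite /= inE ne.
  by move=> z; rewrite !inE mem_filter => /orP[]/eqP->; rewrite ?Px ?Py.
by rewrite size_filter /=; lia.
Qed.

(** * Upper bound for the subleading coefficient in a Schur function *)

Section StraightUpperBound.

Variables (nu a : seq nat) (p q : nat).
Hypotheses (nu_part : is_partition nu) (le_pq : p <= q).
Hypotheses (size_q : q.+1 < size a) (size_nu : size nu <= size a).
Hypotheses (nu_p : 0 < nth 0 nu p) (nu_q : forall i, p < i <= q -> nth 0 nu i = nth 0 nu q).
Hypothesis a_nu : forall e, e < size a -> nth 0 a e + (e == p) = nth 0 nu e + (e == q.+1).

Section Entries.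

Variable f : nat -> nat -> nat.
Hypothesis f_tab : tableau nu [::] a f.

(** Here [p] and [q] are column lengths minus one: the content trades an entry [p.+1] for an entry
    [q.+2]. A cell crosses [s] when it lies in the first [s.+1] rows but carries an entry above
    [s.+1]. *)
Let crosses s (c : nat * nat) := (c.1 <= s) && (s.+1 < f c.1 c.2).

Lemma entry_gt_row i j : j < nth 0 nu i -> i < f i j.
Proof.
move=> lt_j; have := tableau_depth nu_part _ f_tab (i := i) (j := j).
by rewrite in_skew_nil /depth subn0; apply.
Qed.

(** Entries exceed their row index, so the cells of the first [s.+1] rows are those with entry at
    most [s.+1] together with the crossing ones. The two counts are partial sums of [nu] and of [a],
    which differ by 1 exactly for [p <= s <= q]. *)
Lemma count_crosses s : s < size a -> count (crosses s) (cells nu [::]) = (p <= s <= q).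
Proof.
move=> lt_s.
have rows : count (fun c : nat * nat => c.1 < s.+1) (cells nu [::])
          = \sum_(0 <= e < s.+1) nth 0 nu e.
  rewrite -sum_count_eq; apply: eq_bigr => e _; rewrite -(leading_coef_straight e nu_part).
  by apply: eq_count => c; rewrite /depth subn0.
have entries : count (fun c => f c.1 c.2 <= s.+1) (cells nu [::])
             = \sum_(0 <= e < s.+1) nth 0 a e.
  rewrite -(sum_content _ _ _ f_tab) //; case: f_tab => _ _ _ f_cont.
  by apply: eq_big_nat => e ?; rewrite f_cont //; lia.
have diff : \sum_(0 <= e < s.+1) nth 0 a e + (p <= s)
          = \sum_(0 <= e < s.+1) nth 0 nu e + (q.+1 <= s).
  elim: s lt_s {rows entries} => [|s IH] lt_s.
    by have := a_nu lt_s; rewrite !big_nat1; lia.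
  rewrite !(@big_nat_recr _ _ _ s.+1) //=.
  by have := a_nu lt_s; have := IH (ltnW lt_s); lia.
have split_rows : count (crosses s) (cells nu [::])
    + count (fun c => f c.1 c.2 <= s.+1) (cells nu [::])
    = count (fun c : nat * nat => c.1 < s.+1) (cells nu [::]).
  rewrite -count_predUI [X in _ + X](eq_count (a2 := pred0)).
    rewrite count_pred0 addn0; apply: eq_in_count => -[i j].
    by rewrite mem_cells // in_skew_nil /= /crosses /= => /entry_gt_row; lia.
  by move=> c; rewrite /= /crosses; lia.
by lia.
Qed.

Lemma crosses_range s i j : s < size a -> j < nth 0 nu i -> i <= s -> s.+1 < f i j -> p <= s <= q.
Proof.
move=> lt_s lt_j le_i lt_f.
have : 0 < count (crosses s) (cells nu [::]).
  rewrite -has_count; apply/hasP; exists (i, j); last by rewrite /crosses /= le_i.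
  by rewrite mem_cells // in_skew_nil.
by rewrite count_crosses //; case: (p <= s <= q).
Qed.

Lemma crosses_uniq s i j i' j' : s < size a ->
  j < nth 0 nu i -> i <= s -> s.+1 < f i j ->
  j' < nth 0 nu i' -> i' <= s -> s.+1 < f i' j' -> (i, j) = (i', j').
Proof.
move=> lt_s lt_j le_i lt_f lt_j' le_i' lt_f'.
apply: (count_le1_inj (s := cells nu [::]) (P := crosses s)).
- by rewrite count_crosses //; case: (p <= s <= q).
- by rewrite mem_cells // in_skew_nil.
- by rewrite /crosses /= le_i.
- by rewrite mem_cells // in_skew_nil.
- by rewrite /crosses /= le_i'.
Qed.

Lemma crosses_ex s : p <= s <= q ->
  exists i j, [/\ j < nth 0 nu i, i <= s & s.+1 < f i j].
Proof.
move=> ps; have lt_s : s < size a by lia.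
have : 0 < count (crosses s) (cells nu [::]) by rewrite count_crosses // ps.
rewrite -has_count => /hasP[[i j]]; rewrite mem_cells // in_skew_nil /= => lt_j.
by case/andP => *; exists i, j.
Qed.

Lemma row_mono i j j' : j <= j' -> j' < nth 0 nu i -> f i j <= f i j'.
Proof.
rewrite leq_eqVlt => /predU1P[->//|lt_j] lt_j'; case: f_tab => _ f_row _ _.
by apply: f_row; rewrite ?in_skew_nil //; apply: ltn_trans lt_j'.
Qed.

Let k := f p (nth 0 nu p).-1.

(** The cell crossing [p] lies in row [p], since from a higher row it would also cross [p.-1]; the
    last entry of that row is at least as large. An entry above [q.+2] would cross [q.+1]. *)
Lemma corner_entry_range : p.+1 < k <= q.+2.
Proof.
apply/andP; split.
  have [i [j [lt_j le_i lt_f]]] : exists i j, [/\ j < nth 0 nu i, i <= p & p.+1 < f i j].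
    by apply: crosses_ex; lia.
  have Ei : i = p.
    apply/eqP; rewrite eqn_leq le_i leqNgt; apply/negP => lt_ip.
    have lt_s : p.-1 < size a by lia.
    have le_ip : i <= p.-1 by lia.
    have lt_f' : p.-1.+1 < f i j by lia.
    by have := crosses_range lt_s lt_j le_ip lt_f'; lia.
  rewrite {}Ei in lt_j lt_f; apply: leq_trans lt_f _.
  by apply: row_mono; lia.
rewrite leqNgt; apply/negP => lt_k.
have le_p : p <= q.+1 by lia.
have lt_c : (nth 0 nu p).-1 < nth 0 nu p by lia.
by have := crosses_range size_q lt_c le_p lt_k; lia.
Qed.

(** The whole tableau is determined by the corner entry [k], because each [s] is crossed by at most
    one cell. *)
Lemma entry_explicit i j : j < nth 0 nu i ->
  f i j = if (p <= i <= q) && (j.+1 == nth 0 nu i) then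
            if i == p then k else if i.+1 < k then i.+1 else i.+2
          else i.+1.
Proof.
move=> lt_j; have gt_i := entry_gt_row lt_j.
have lt_ia : i < size a.
  apply: leq_trans size_nu; rewrite ltnNge; apply/negP => /(nth_default 0) E.
  by rewrite E in lt_j.
have nocross : ~~ (i.+1 < f i j) -> f i j = i.+1 by lia.
have lt_c : (nth 0 nu p).-1 < nth 0 nu p by lia.
have /andP[k_gt k_le] := corner_entry_range.
have [pi|npi] /= := boolP (p <= i <= q); last first.
  apply: nocross; apply: contra npi => lt_f.
  exact: crosses_range lt_ia lt_j (leqnn i) lt_f.
case: eqP => [Ej|ne]; last first.
  apply: nocross; apply/negP => lt_f.
  have lt_last : (nth 0 nu i).-1 < nth 0 nu i by lia.
  have lt_f' : i.+1 < f i (nth 0 nu i).-1 by apply: leq_trans lt_f (row_mono _ _); lia.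
  have [] := crosses_uniq lt_ia lt_j (leqnn i) lt_f lt_last (leqnn i) lt_f'.
  by lia.
case: eqP => [Ei|ne]; first by rewrite /k -Ei -Ej.
have lt_pi : p < i by lia.
(* If [i.+1 < k], the corner of row [p] already crosses [i], so the cell in row [i] cannot. *)
case: ifP => [lt_ik|ge_ik].
  apply: nocross; apply/negP => lt_f.
  have [E _] := crosses_uniq lt_ia lt_j (leqnn i) lt_f lt_c (ltnW lt_pi) lt_ik.
  by case: ne.
have col_step i1 i2 : i1 <= i2 -> j < nth 0 nu i1 -> j < nth 0 nu i2 ->
    f i1 j + (i2 - i1) <= f i2 j.
  move=> le_i lt1; rewrite -(subnKC le_i) addKn.
  elim: (i2 - i1) => [|d IH] lt2; first by rewrite !addn0.
  rewrite !addnS in lt2 *.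
  have lt2' : j < nth 0 nu (i1 + d) by apply: leq_trans lt2 (partition_nth_anti nu_part _).
  apply: leq_ltn_trans (IH lt2') _.
  by case: f_tab => _ _ f_col _; apply: f_col; rewrite ?in_skew_nil.
have [i' [j' [lt_j' le_i' lt_f']]] := crosses_ex pi.
(* Above row [p] the cell would also cross [p.-1]; in row [p] its entry would be at most [k], hence
   at most [i.+1]. *)
have lt_pi' : p < i'.
  rewrite ltnNge; apply/negP; rewrite leq_eqVlt => /predU1P[E|lt_i'p]; last first.
  - have lt1 : p.-1 < size a by lia.
    have le1 : i' <= p.-1 by lia.
    have lt2 : p.-1.+1 < f i' j' by lia.
    by have := crosses_range lt1 lt_j' le1 lt2; lia.
  rewrite E in lt_j' lt_f'.
  have : f p j' <= k by apply: row_mono; lia.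
  by lia.
(* The unique crossing cell ends its row, as any cell to its right would cross too. Rows [p.+1] to
   [q] have equal length, so it lies in column [j]. *)
have Ej' : j'.+1 = nth 0 nu i.
  apply/eqP; rewrite (nu_q (i := i)); last by lia.
  rewrite -(nu_q (i := i')); last by lia.
  rewrite eqn_leq lt_j' leqNgt; apply/negP => lt_j'1.
  have lt_last : (nth 0 nu i').-1 < nth 0 nu i' by lia.
  have lt_fl : i.+1 < f i' (nth 0 nu i').-1 by apply: leq_trans lt_f' (row_mono _ _); lia.
  have [] := crosses_uniq lt_ia lt_j' le_i' lt_f' lt_last le_i' lt_fl.
  by lia.
have Ejj : j' = j by lia.
rewrite {j'}Ejj in lt_j' lt_f' Ej'.
have ge_i2 : i.+1 < f i j by have := col_step _ _ le_i' lt_j' lt_j; lia.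
(* A larger entry would make both this cell and the one below it cross [i.+1]. *)
have le_i2 : f i j <= i.+2; last by lia.
rewrite leqNgt; apply/negP => lt_f.
have lt_i1a : i.+1 < size a by lia.
have lt_iq : i < q by have := crosses_range lt_i1a lt_j (leqnSn i) lt_f; lia.
have lt_j1 : j < nth 0 nu i.+1.
  by rewrite nu_q; [rewrite -(nu_q (i := i)) //; lia|lia].
have lt_f1 : i.+2 < f i.+1 j by have := col_step _ _ (leqnSn i) lt_j lt_j1; lia.
have [] := crosses_uniq lt_i1a lt_j (leqnSn i) lt_f lt_j1 (leqnn _) lt_f1.
by lia.
Qed.

End Entries.

Lemma coef_straight_upper : skew_schur_coef nu [::] a <= (q - p).+1.
Proof.
apply: (coef_upper nu_part (G := fun f => f p (nth 0 nu p).-1 - p.+2)).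
  by move=> f /corner_entry_range; lia.
move=> f g f_tab g_tab E i j; rewrite in_skew_nil => lt_j.
rewrite (entry_explicit f_tab) // (entry_explicit g_tab) //.
have := corner_entry_range f_tab; have := corner_entry_range g_tab.
by move: E; set kf := f p _; set kg := g p _ => *; have -> : kf = kg by lia.
Qed.

End StraightUpperBound.

(** The map [bump k] sends [[0, n)] onto [[0, n]] without [k]. *)
Lemma count_bump n k (P : pred nat) : k <= n ->
  count (fun d => P (bump k d)) (iota 0 n) + P k = count P (iota 0 n.+1).
Proof.
move=> le_kn; rewrite -{1}(subnKC le_kn) -(subnKC (leqW le_kn)) !iotaD !count_cat !add0n.
rewrite subSn //= (iotaDl 1 k) count_map.
have -> : count (fun d => P (bump k d)) (iota 0 k) = count P (iota 0 k).
  by apply: eq_in_count => d; rewrite mem_iota /bump add0n => /andP[_]; rewrite ltnNge => /negbTE->.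
have -> : count (fun d => P (bump k d)) (iota k (n - k)) = count (preim (addn 1) P) (iota k (n - k)).
  by apply: eq_in_count => d; rewrite mem_iota /bump /= => /andP[->].
by rewrite -addnA [_ + P k]addnC.
Qed.

(** * Lower bound for the same coefficient in a skew Schur function *)

Section SkewLowerBound.

Variables (la mu a : seq nat) (x y p q : nat).
Hypotheses (la_part : is_partition la) (mu_part : is_partition mu).
Hypothesis mu_sub : forall i, nth 0 mu i <= nth 0 la i.

Let t := conj_part mu.
Let b := conj_part la.

Hypotheses (ne_xy : x != y) (le_pq : p <= q).
Hypotheses (b_x : b x = t x + p.+1) (b_y : b y = t y + q.+1).
Hypothesis right_of_x : forall c, x < c -> b c = b x -> t c + q.+1 < b c.
Hypothesis right_of_y : forall c, y < c -> t c = t y -> b c <= t c + p.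
Hypotheses (size_q : q.+1 < size a) (size_la : size la <= size a).
Hypothesis a_coef : forall e, e < size a ->
  nth 0 a e + (e == p) = leading_coef la mu e + (e == q.+1).

(* The column of [x] becomes 1, ..., p, k+1 and that of [y] becomes
   1, ..., q+2 without k+1. *)
Definition two_column_filling k i j :=
  if (j == x) && (depth mu i j == p) then k.+1
  else if j == y then (bump k (depth mu i j)).+1 else (depth mu i j).+1.

(** Column [x] trades [p.+1] for [k.+1] and column [y] trades [k.+1] for [q.+2]; the entry [k.+1]
    cancels. *)
Lemma content_two_column k e : p <= k <= q.+1 ->
  content la mu (two_column_filling k) e.+1 + (e == p)
  = leading_coef la mu e + (e == q.+1).
Proof.
move=> pkq; rewrite /leading_coef /content !count_cols // -/t -/b.
have lt_x : x < head 0 la by rewrite -conj_part_gt0 // -/b; lia.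
have lt_y : y < head 0 la by rewrite -conj_part_gt0 // -/b; lia.
have split_xy (F : nat -> nat) : \sum_(0 <= j < head 0 la) F j
    = F x + (F y + \sum_(j < head 0 la | (j != x :> nat) && (j != y :> nat)) F j).
  rewrite big_mkord (bigD1 (Ordinal lt_x)) //= (bigD1 (Ordinal lt_y)) //=.
  by rewrite -val_eqE /= eq_sym.
rewrite !{}split_xy.
have colx : count (fun d => two_column_filling k (t x + d) x == e.+1) (iota 0 (b x - t x))
    + (e == p) = count (fun d => depth mu (t x + d) x == e) (iota 0 (b x - t x)) + (k == e).
  rewrite b_x addKn -[in iota _ _]addn1 iotaD !count_cat /= add0n.
  rewrite /two_column_filling /depth -/t addKn !eqxx /= eqSS !addn0 (eq_sym e p).
  rewrite addnAC; congr (addn (addn _ _) _); apply: eq_in_count => d.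
  rewrite mem_iota add0n => /andP[_ lt_d].
  by rewrite addKn (ltn_eqF lt_d) (negbTE ne_xy).
have coly : count (fun d => two_column_filling k (t y + d) y == e.+1) (iota 0 (b y - t y))
    + (k == e) = count (fun d => depth mu (t y + d) y == e) (iota 0 (b y - t y)) + (e == q.+1).
  rewrite b_y addKn; case/andP: pkq => _; move: q.+1 => n le_kn.
  rewrite (eq_count (a2 := fun d => pred1 e (bump k d))); last first.
    by move=> d; rewrite /two_column_filling /depth -/t addKn (eq_sym y) (negbTE ne_xy) eqxx.
  rewrite (count_bump (pred1 e)) // -[in iota _ _.+1]addn1 iotaD count_cat /= add0n addn0.
  congr (addn _ _); last by rewrite eq_sym.
  by apply: eq_count => d; rewrite /depth -/t addKn.
rewrite [X in _ + (_ + X) + _ = _](eq_bigr (fun j : 'I__ =>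
    count (fun d => depth mu (t j + d) j == e) (iota 0 (b j - t j)))); last first.
  move=> j /andP[ne_x ne_y]; apply: eq_count => d.
  by rewrite /two_column_filling (negbTE ne_x) (negbTE ne_y).
rewrite /= (eq_sym k) in colx coly *; move: colx coly; lia.
Qed.

(** No entry drops below its depth plus one, so a row can fail only to the right of a raised entry,
    in column [x] or [y]. The hypotheses on the columns further right exclude this. *)
Lemma tableau_two_column k : p <= k <= q.+1 ->
  tableau la mu a (two_column_filling k).
Proof.
move=> pkq; have std := tableau_depth_filling la_part mu_part size_la.
have t_anti i j : i <= j -> t j <= t i by apply: conj_part_anti.
have b_anti i j : i <= j -> b j <= b i by apply: conj_part_anti.
split.
- move=> i j c_in; have /andP[lt_i _] := in_skew_bound la_part c_in.
  move: c_in; rewrite in_skew_conj // -/t -/b /two_column_filling /depth -/t /bump => c_in.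
  case: ifP => [_|_]; first by lia.
  by case: eqP => [Ej|_]; [rewrite Ej in c_in *|]; lia.
- move=> i c c'; rewrite !in_skew_conj // -/t -/b => c_in c'_in lt_c.
  have le_t := t_anti _ _ (ltnW lt_c); have le_b := b_anti _ _ (ltnW lt_c).
  rewrite /two_column_filling /depth -/t /bump.
  have lower : i - t c' < (if (c' == x) && (i - t c' == p) then k.+1
    else if c' == y then ((k <= i - t c') + (i - t c')).+1 else (i - t c').+1).
    by do ![case: ifP => ?]; lia.
  case: ifP => [/andP[/eqP Ec /eqP Ep]|_].
    rewrite Ec in c_in le_t le_b lt_c Ep.
    (* A column meeting the bottom row of [x] further right ends in that row. By [right_of_x] its
       depth there is at least [q.+1], so its entry is at least [k.+1]. *)
    have Eb : b c' = b x by lia.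
    by have := right_of_x lt_c Eb; lia.
  case: eqP => [Ec|_]; last by lia.
  rewrite Ec in c_in le_t le_b lt_c *.
  (* A strictly higher top makes the depth larger by at least one, which absorbs the bump. With
     equal tops the depth is below [p], hence below [k], and nothing was bumped. *)
  have [Et|] := eqVneq (t c') (t y); last by lia.
  by have := right_of_y lt_c Et; lia.
- move=> i i' c; rewrite !in_skew_conj // -/t -/b => c_in c'_in lt_i.
  rewrite /two_column_filling /depth -/t /bump.
  case: (eqVneq c x) => [Ec|_] /=; last by case: ifP => _; lia.
  rewrite Ec in c_in c'_in *; rewrite (negbTE ne_xy).
  by do ![case: eqP => ?]; lia.
move=> e lt_e; have := content_two_column e pkq; have := a_coef lt_e; lia.
Qed.

Lemma coef_skew_lower : (q - p).+2 <= skew_schur_coef la mu a.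
Proof.
apply: (coef_lower la_part (F := fun k => two_column_filling (p + k))).
  by move=> k lt_k; apply: tableau_two_column; lia.
move=> k k' _ _ /(_ (t x + p) x); rewrite in_skew_conj // -/t -/b.
rewrite /two_column_filling /depth -/t addKn !eqxx /= => E.
have /E : t x <= t x + p < b x by lia.
lia.
Qed.

End SkewLowerBound.

Lemma count_iota_le n i j (P : pred nat) :
  (forall c, P c -> i <= c < j) -> count P (iota 0 n) <= j - i.
Proof.
move=> P_in; rewrite -size_filter -(size_iota i (j - i)).
apply: uniq_leq_size; first by rewrite filter_uniq ?iota_uniq.
by move=> c; rewrite mem_filter !mem_iota => /andP[/P_in c_in _]; lia.
Qed.

Lemma count_iota_ge n i j (P : pred nat) : j <= n ->
  (forall c, i <= c < j -> P c) -> j - i <= count P (iota 0 n).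
Proof.
move=> le_jn P_in; rewrite -size_filter -(size_iota i (j - i)).
apply: uniq_leq_size; first exact: iota_uniq.
move=> c; rewrite mem_filter !mem_iota => c_in; rewrite P_in; lia.
Qed.

(** * Alignment of the columns *)

Section SchurSkew.

Variables (la mu nu : seq nat).
Hypotheses (la_part : is_partition la) (mu_part : is_partition mu).
Hypotheses (nu_part : is_partition nu) (mu_sub : forall i, nth 0 mu i <= nth 0 la i).
Hypothesis eq_schur : skew_schur_eq la mu nu [::].

Let t := conj_part mu.
Let b := conj_part la.
Let len j := b j - t j.

(** Otherwise one coefficient would be at least [(q - p).+2] for [la/mu] and at most [(q - p).+1]
    for [nu], where the columns have lengths [p.+1] and [q.+1]. *)
Lemma no_two_column_moves x y : x != y -> 0 < len x <= len y ->
  (forall c, len x < len c -> len y <= len c) ->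
  (forall c, x < c -> b c = b x -> len y < len c) ->
  ~ (forall c, y < c -> t c = t y -> len c < len x).
Proof.
move=> ne_xy; case Ex: (len x) => [|p] //; case Ey: (len y) => [|q] //= le_pq.
move=> gap right_x right_y.
have coefE := leading_coef_schur_eq _ la_part mu_part nu_part mu_sub eq_schur.
(* The truncated subtraction is exact by [p_gt0]. The length leaves room for both shapes and for the
   index [q.+1]. *)
pose a := mkseq (fun e => leading_coef la mu e + (e == q.+1) - (e == p))
                (size la + size nu + q.+2).
have p_gt0 : 0 < leading_coef la mu p.
  by apply: (leading_coef_gt0 la_part mu_part (x := x)); rewrite -/t -/b -/(len x) Ex.
have aE e : e < size a -> nth 0 a e + (e == p) = leading_coef la mu e + (e == q.+1).
  rewrite size_mkseq => lt_e; rewrite nth_mkseq //.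
  by case: (eqVneq e p) => [->|_]; lia.
have size_a : size a = size la + size nu + q.+2 by rewrite size_mkseq.
have lower : (q - p).+2 <= skew_schur_coef la mu a.
  apply: (coef_skew_lower (x := x) (y := y)) => //.
  - by move: Ex; rewrite /len /t /b; lia.
  - by move: Ey; rewrite /len /t /b; lia.
  - by move=> c lt_c /(right_x _ lt_c); rewrite /len /t /b; lia.
  - by move=> c lt_c /(right_y _ lt_c); rewrite /len /t /b; lia.
  - by rewrite size_a; lia.
  - by rewrite size_a; lia.
have upper : skew_schur_coef nu [::] a <= (q - p).+1.
  apply: coef_straight_upper => //.
  - by rewrite size_a; lia.
  - by rewrite size_a; lia.
  - by rewrite -coefE.
  - move=> i pi; rewrite -!coefE !leading_coefE //; apply: eq_count => c.
    by have := gap c; rewrite -/t -/b -/(len c); lia.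
  by move=> e lt_e; rewrite -coefE aE.
by move: lower; rewrite eq_schur; lia.
Qed.

(** Every column further right differs from this one in its top or its bottom, so sharing one end
    makes the other end strictly higher. *)
Lemma last_twin x : 0 < len x ->
  exists x', [/\ t x' = t x, b x' = b x
    & forall c, x' < c -> t c = t x -> b c = b x -> false].
Proof.
move=> lt_x; pose P c := (t c == t x) && (b c == b x).
have exP : exists c, P c by exists x; rewrite /P !eqxx.
have P_le c : P c -> c <= head 0 la.
  move=> /andP[_ /eqP Eb]; apply: ltnW.
  by rewrite -conj_part_gt0 // -/b Eb; move: lt_x; rewrite /len; lia.
case: (ex_maxnP exP P_le) => x' /andP[/eqP Et /eqP Eb] x'_max; exists x'; split=> //.
move=> c lt_c Etc Ebc; have := x'_max c; rewrite /P Etc Ebc !eqxx => /(_ isT).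
by rewrite leqNgt lt_c.
Qed.

Let t_anti i j : i <= j -> t j <= t i.
Proof. exact: conj_part_anti. Qed.

Let b_anti i j : i <= j -> b j <= b i.
Proof. exact: conj_part_anti. Qed.

(** If the tops differed, the rightmost twins would admit the two-column moves: to the right, a
    column with the bottom of [x] is longer, and one with the top of [y] is shorter. *)
Lemma same_len_same_rows x y : 0 < len x -> len x = len y -> t x = t y /\ b x = b y.
Proof.
move=> lt_x Exy; have lt_y : 0 < len y by rewrite -Exy.
have [x' [tx bx x'_last]] := last_twin lt_x; have [y' [ty by_ y'_last]] := last_twin lt_y.
have Ex' : len x' = len x by rewrite /len tx bx.
have Ey' : len y' = len x by rewrite Exy /len ty by_.
have [E|ne] := eqVneq (t x) (t y).
  by split=> //; move: Exy lt_x; rewrite /len E; lia.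
have ne_xy' : x' != y' by apply: contra ne => /eqP E; rewrite -tx -ty E.
case: (@no_two_column_moves x' y' ne_xy'); rewrite ?Ex' ?Ey' ?leqnn ?andbT //.
- by move=> c; lia.
- move=> c lt_c Ec; have := t_anti (ltnW lt_c).
  have [Et|] := eqVneq (t c) (t x).
    by have := x'_last c lt_c Et; rewrite Ec bx => /(_ erefl).
  by move: lt_x; rewrite -Ex' /len; lia.
move=> c lt_c Ec; have := b_anti (ltnW lt_c).
have [Eb|] := eqVneq (b c) (b y).
  by have := y'_last c lt_c; rewrite Ec ty Eb => /(_ erefl erefl).
by move: lt_y; rewrite Exy /len; lia.
Qed.

(** As for equal lengths, but to the right of [x] the columns with its bottom must be longer than
    [y], and to the right of [y] those with its top shorter than [x]. The gap in lengths gives the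
    weak inequalities and [same_len_same_rows] excludes equality. *)
Lemma next_len_share x y : 0 < len x -> len x < len y ->
  (forall c, len x < len c -> len y <= len c) -> t x = t y \/ b x = b y.
Proof.
move=> lt_x lt_xy gap; have lt_y : 0 < len y by lia.
have [x' [tx bx x'_last]] := last_twin lt_x; have [y' [ty by_ y'_last]] := last_twin lt_y.
have Ex' : len x' = len x by rewrite /len tx bx.
have Ey' : len y' = len y by rewrite /len ty by_.
have [|net] := eqVneq (t x) (t y); first by left.
have [|neb] := eqVneq (b x) (b y); first by right.
have ne_xy' : x' != y' by apply: contra net => /eqP E; rewrite -tx -ty E.
case: (@no_two_column_moves x' y' ne_xy'); rewrite ?Ex' ?Ey' ?(ltnW lt_xy) ?lt_x //.
- move=> c lt_c Ec; rewrite bx in Ec; have le_t := t_anti (ltnW lt_c).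
  have lt_len : len x < len c.
    have [Et|] := eqVneq (t c) (t x).
      by have := x'_last c lt_c Et; rewrite Ec => /(_ erefl).
    by move: lt_x le_t; rewrite /len Ec tx; lia.
  have := gap c lt_len; rewrite leq_eqVlt => /predU1P[E|//].
  by have [_ E'] := same_len_same_rows lt_y E; rewrite E' Ec eqxx in neb.
move=> c lt_c Ec; rewrite ty in Ec; have le_b := b_anti (ltnW lt_c).
have lt_len : len c < len y.
  have [Eb|] := eqVneq (b c) (b y).
    by have := y'_last c lt_c; rewrite Ec Eb => /(_ erefl erefl).
  by move: lt_y le_b; rewrite /len Ec by_; lia.
have le_len : len c <= len x.
  by rewrite leqNgt; apply/negP => /gap; rewrite leqNgt lt_len.
move: le_len; rewrite leq_eqVlt => /predU1P[E|//].
have [E' _] := same_len_same_rows lt_x (esym E).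
by rewrite E' Ec eqxx in net.
Qed.

(** Induction on a bound for the lengths: columns of the new length share an end with those of the
    next smaller length, and monotonicity reconciles this end with the one given by induction. *)
Lemma aligned : (forall x y, 0 < len x -> 0 < len y -> t x = t y) \/
                (forall x y, 0 < len x -> 0 < len y -> b x = b y).
Proof.
have aligned_upto n :
    (forall x y, 0 < len x <= n -> 0 < len y <= n -> t x = t y) \/
    (forall x y, 0 < len x <= n -> 0 < len y <= n -> b x = b y).
  elim: n => [|n IH]; first by left=> x y; lia.
  have len_ex l : 0 < l -> (exists y, len y = l) \/ (forall y, len y != l).
    move=> lt_l; case: (boolP (has (fun y => len y == l) (iota 0 (head 0 la)))).
      by case/hasP=> y _ /eqP; left; exists y.
    move/hasPn=> none; right=> y; apply/negP => /eqP Ey.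
    have : y \in iota 0 (head 0 la).
      by rewrite mem_iota add0n -conj_part_gt0 // -/b; move: Ey; rewrite /len; lia.
    by move/none; rewrite Ey eqxx.
  have [[y Ey]|no_y] := len_ex n.+1 (ltn0Sn n); last first.
    have le_n x : 0 < len x <= n.+1 -> 0 < len x <= n by have := no_y x; lia.
    by case: IH => IH; [left|right] => x x' /le_n x_in /le_n x'_in; apply: IH.
  have rows_y u : len u = n.+1 -> t u = t y /\ b u = b y.
    by move=> Eu; apply: same_len_same_rows; rewrite Eu ?Ey.
  (* Either [x] has the largest positive length at most [n], or there is no such length. *)
  have next : (exists x, 0 < len x <= n /\ forall c, len x < len c -> n < len c)
      \/ (forall c, 0 < len c -> n < len c).
    elim: (n) => [|m [[x [x_in x_max]]|none]]; first by right.
    - have [[x' Ex']|no_x'] := len_ex m.+1 (ltn0Sn m).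
        by left; exists x'; rewrite Ex'; split=> //; lia.
      left; exists x; split=> [|c lt_c]; first by lia.
      by have := x_max c lt_c; have := no_x' c; lia.
    - have [[x' Ex']|no_x'] := len_ex m.+1 (ltn0Sn m).
        by left; exists x'; rewrite Ex'; split=> //; lia.
      by right=> c lt_c; have := none c lt_c; have := no_x' c; lia.
  case: next => [[x [x_in x_max]]|none]; last first.
    left=> u v u_in v_in; have Eu : len u = n.+1 by have := none u; lia.
    by apply: (same_len_same_rows _ _).1; [lia|have := none v; lia].
  have cases_u u : 0 < len u <= n.+1 -> 0 < len u <= len x \/ t u = t y /\ b u = b y.
    move=> u_in; have [Eu|ne] := eqVneq (len u) n.+1; first by right; apply: rows_y.
    by left; have := x_max u; lia.
  suff : (forall u, 0 < len u <= n.+1 -> t u = t x) \/ (forall u, 0 < len u <= n.+1 -> b u = b x).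
    by case=> H; [left|right] => u v u_in v_in; rewrite (H u) // (H v).
  have share : t x = t y \/ b x = b y.
    by apply: next_len_share; [lia|lia|move=> c /x_max; rewrite Ey].
  have t_le u := @t_anti u y; have t_ge u := @t_anti y u.
  have b_le u := @b_anti u y; have b_ge u := @b_anti y u.
  (* In the mixed cases, say equal tops so far but [b x = b y], the longer column [y] starts higher,
     so every shorter [u] lies to its left and ends no higher than [y]. Being no longer than [x],
     with the same top, it also ends no lower. *)
  case: IH share => IH [E|E].
  - left=> u /cases_u[u_in|[-> _]//]; apply: IH; lia.
  - right=> u /cases_u[u_in|[_ ->]//]; have Et : t u = t x by apply: IH; lia.
    have := t_ge u; have := b_le u; move: u_in x_in Ey; rewrite /len.
    by case: (leqP u y) => ?; lia.
  - left=> u /cases_u[u_in|[-> _]//]; have Eb : b u = b x by apply: IH; lia.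
    have := t_ge u; have := b_le u; move: u_in x_in Ey; rewrite /len.
    by case: (leqP u y) => ?; lia.
  - right=> u /cases_u[u_in|[_ ->]//]; apply: IH; lia.
have le_len x : 0 < len x -> 0 < len x <= size la.
  move=> ->; apply: leq_trans (leq_subr _ _) _; exact: count_size.
by case: (aligned_upto (size la)) => H; [left|right] => x y /le_len x_in /le_len y_in; apply: H.
Qed.

(** * From aligned columns to the shape of the diagram *)

Hypothesis connected : skew_connected la mu.

Lemma in_skewE i j : in_skew la mu i j = (t j <= i < b j).
Proof. exact: in_skew_conj. Qed.

(** At an empty column all cells to its left lie in rows from [b c2] on, and all cells to its right
    in earlier rows. The nonempty rows nearest to this division would share no column, against
    connectedness. *)
Lemma nonempty_cols_convex c1 c2 c3 : c1 <= c2 <= c3 ->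
  0 < len c1 -> 0 < len c3 -> 0 < len c2.
Proof.
move=> c_in lt1 lt3; rewrite lt0n; apply/negP => /eqP len0.
have t2 : t c2 = b c2 by have := conj_part_sub la_part mu_part mu_sub c2; move: len0; rewrite /len /t /b; lia.
have below i j : in_skew la mu i j -> (j < c2 -> b c2 <= i) /\ (c2 < j -> i < b c2).
  rewrite in_skewE => ij; split=> lt_j.
    by have := t_anti (ltnW lt_j); lia.
  by have := b_anti (ltnW lt_j); lia.
have ne_row i j : in_skew la mu i j -> row_nonempty la mu i.
  by rewrite /in_skew /row_nonempty; apply/implyP; lia.
have cell1 : in_skew la mu (t c1) c1 by rewrite in_skewE; move: lt1; rewrite /len; lia.
have cell3 : in_skew la mu (t c3) c3 by rewrite in_skewE; move: lt3; rewrite /len; lia.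
have lt12 : c1 < c2 by move: lt1; have := @b_anti c1 c2; case: (ltngtP c1 c2) => // [|->]; lia.
have lt23 : c2 < c3 by move: lt3; case: (ltngtP c2 c3) => // [|<-]; lia.
have P1 : exists i, row_nonempty la mu i && (b c2 <= i).
  by exists (t c1); rewrite (ne_row _ _ cell1) /=; apply: (below _ _ cell1).1.
have P3 : exists i, row_nonempty la mu i && (i < b c2).
  by exists (t c3); rewrite (ne_row _ _ cell3) /=; apply: (below _ _ cell3).2.
have P3_le i : row_nonempty la mu i && (i < b c2) -> i <= b c2 by case/andP=> _ /ltnW.
case: (ex_minnP P1) => i1 /andP[ne1 ge1] min1.
case: (ex_maxnP P3 P3_le) => i3 /andP[ne3 lt3'] max3.
have gap k : i3 < k < i1 -> ~~ row_nonempty la mu k.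
  case/andP=> gt_k lt_k; apply/negP => ne_k; have [le_k|lt_k'] := leqP (b c2) k.
    by have := min1 k; rewrite ne_k le_k => /(_ isT); lia.
  by have := max3 k; rewrite ne_k lt_k' => /(_ isT); lia.
have [c /andP[cell3' cell1']] := connected (leq_trans lt3' ge1) ne3 ne1 gap.
have := below _ _ cell3'; have := below _ _ cell1'.
move: cell1'; rewrite in_skewE => cell1' [H1 H1'] [H3 H3'].
case: (ltngtP c c2) => [/H3|/H1'|Ec]; [lia|lia|].
by rewrite Ec in cell1'; lia.
Qed.

Let nu_count k : nth 0 nu k = count (fun c => k < len c) (iota 0 (head 0 la)).
Proof. by rewrite -(leading_coef_schur_eq _ la_part mu_part nu_part mu_sub) // leading_coefE. Qed.

Lemma nonempty_lt_head c : 0 < len c -> c < head 0 la.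
Proof. by rewrite -conj_part_gt0 // -/b /len; lia. Qed.

(** From the leftmost nonempty column [A] on, the nonempty columns form an interval with a common
    top and weakly decreasing lengths. Those longer than [d] are therefore the first [nth 0 nu d] of
    them. *)
Lemma top_aligned_shape x : 0 < len x ->
  (forall x y, 0 < len x -> 0 < len y -> t x = t y) -> skew_eq_shape la mu nu.
Proof.
move=> x_ne tops.
have exA : exists c, 0 < len c by exists x.
case: (ex_minnP exA) => A A_ne A_min.
have shape i j : in_skew la mu i j = [&& t A <= i, A <= j & j - A < nth 0 nu (i - t A)].
  rewrite in_skewE nu_count; apply/idP/idP => [c_in|/and3P[le_i le_j]].
    have j_ne : 0 < len j by rewrite /len; lia.
    have Et := tops _ _ A_ne j_ne; have le_A := A_min _ j_ne.
    rewrite le_A /=; have -> /= : t A <= i by lia.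
    apply: leq_trans (count_iota_ge (i := A) (nonempty_lt_head j_ne) _); first by lia.
    move=> c c_in'; have c_ne : 0 < len c.
      by apply: (nonempty_cols_convex (c1 := A) (c3 := j)) => //; lia.
    have := tops _ _ A_ne c_ne; have : b j <= b c by apply: b_anti; lia.
    by rewrite /len; lia.
  rewrite ltnNge; apply: contraNT => notin; apply: count_iota_le => c lt_c.
  have c_ne : 0 < len c by lia.
  rewrite A_min //=; rewrite ltnNge; apply: contra notin => le_jc.
  have j_ne : 0 < len j.
    by apply: (nonempty_cols_convex (c1 := A) (c3 := c)) => //; lia.
  have := tops _ _ A_ne j_ne; have := tops _ _ A_ne c_ne; have := b_anti le_jc.
  by move: lt_c; rewrite /len; lia.
exists (Posz (t A)), (Posz A) => i j.
case Ei: (i - _)%R => [m|m]; case Ej: (j - _)%R => [n|n]; case: i Ei => i Ei; case: j Ej => j Ej;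
  rewrite /= ?shape ?in_skew_nil //; try lia.
have -> : m = i - t A by lia.
have -> : n = j - A by lia.
lia.
Qed.

(** The mirror image: lengths weakly increase up to the rightmost nonempty column [Z], and the half
    turn sends its bottom cell to the origin. *)
Lemma bottom_aligned_shape x : 0 < len x ->
  (forall x y, 0 < len x -> 0 < len y -> b x = b y) -> skew_eq_rot_shape la mu nu.
Proof.
move=> x_ne bots.
have exZ : exists c, 0 < len c by exists x.
have Z_le c : 0 < len c -> c <= head 0 la by move/nonempty_lt_head/ltnW.
case: (ex_maxnP exZ Z_le) => Z Z_ne Z_max.
have shape i j :
    in_skew la mu i j = [&& i <= (b Z).-1, j <= Z & Z - j < nth 0 nu ((b Z).-1 - i)].
  rewrite in_skewE nu_count; apply/idP/idP => [c_in|/and3P[le_i le_j]].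
    have j_ne : 0 < len j by rewrite /len; lia.
    have Eb := bots _ _ Z_ne j_ne; have le_Z := Z_max _ j_ne.
    rewrite le_Z /=; have -> /= : i <= (b Z).-1 by lia.
    apply: leq_trans (count_iota_ge (i := j) (nonempty_lt_head Z_ne) _); first by lia.
    move=> c c_in'; have c_ne : 0 < len c.
      by apply: (nonempty_cols_convex (c1 := j) (c3 := Z)) => //; lia.
    have := bots _ _ Z_ne c_ne; have : t c <= t j by apply: t_anti; lia.
    by rewrite /len; lia.
  rewrite ltnNge; apply: contraNT => notin.
  rewrite -(subSS j Z); apply: count_iota_le => c lt_c.
  have c_ne : 0 < len c by lia.
  rewrite ltnS Z_max // andbT ltnNge; apply: contra notin => le_cj.
  have j_ne : 0 < len j.
    by apply: (nonempty_cols_convex (c1 := c) (c3 := Z)) => //; lia.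
  have := bots _ _ Z_ne j_ne; have := bots _ _ Z_ne c_ne; have := t_anti le_cj.
  by move: lt_c Z_ne; rewrite /len; lia.
(* This bound and the next ensure that no cell of [nu] is rotated to a negative row or column. *)
have rows_le m : b Z <= m -> nth 0 nu m = 0.
  move=> le_m; rewrite nu_count (eq_count (a2 := pred0)) ?count_pred0 // => c /=.
  by have := bots Z c Z_ne; rewrite /len; lia.
have cols_le m : nth 0 nu m <= Z.+1.
  rewrite nu_count -[Z.+1]subn0; apply: count_iota_le => c lt_c.
  by rewrite /= ltnS Z_max //; lia.
exists (Posz (b Z).-1), (Posz Z) => i j.
case Ei: (_ - i)%R => [m|m]; case Ej: (_ - j)%R => [n|n]; case: i Ei => i Ei; case: j Ej => j Ej;
  rewrite /= ?shape ?in_skew_nil //; try (have := cols_le m); try (have := rows_le m); try lia.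
have -> : m = (b Z).-1 - i by lia.
have -> : n = Z - j by lia.
lia.
Qed.

Lemma empty_shape : (forall x, len x = 0) -> skew_eq_shape la mu nu.
Proof.
move=> empty; exists 0%R, 0%R => i j; rewrite !GRing.subr0.
case: i => i //; case: j => j //=; rewrite in_skewE in_skew_nil nu_count.
rewrite (eq_count (a2 := pred0)) ?count_pred0 => [|c]; last by rewrite empty.
by have := empty j; rewrite /len; lia.
Qed.

Lemma schur_eq_shape : skew_eq_shape la mu nu \/ skew_eq_rot_shape la mu nu.
Proof.
case: (boolP (has (fun x => 0 < len x) (iota 0 (head 0 la)))) => [/hasP[x _ x_ne]|/hasPn none].
  by case: aligned => ?; [left; apply: top_aligned_shape x_ne _|right; apply: bottom_aligned_shape x_ne _].
left; apply: empty_shape => x; apply/eqP; rewrite -leqn0 leqNgt; apply/negP => x_ne.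
have : x \in iota 0 (head 0 la) by rewrite mem_iota add0n nonempty_lt_head.
by move/none; rewrite x_ne.
Qed.

End SchurSkew.

(** * Translated and rotated shapes have equal Schur functions *)

Lemma shape_schur_eq la mu nu : is_partition la -> is_partition nu ->
  skew_eq_shape la mu nu -> skew_schur_eq la mu nu [::].
Proof.
move=> la_part nu_part [a [b shape]] c.
(* Taking [absz] loses nothing on cells, since [in_skewZ] is false at negative coordinates. *)
have toD i j : in_skew la mu i j ->
    [/\ in_skew nu [::] (absz (Posz i - a)%R) (absz (Posz j - b)%R),
        absz (Posz (absz (Posz i - a)%R) + a)%R = i
      & absz (Posz (absz (Posz j - b)%R) + b)%R = j].
  rewrite -[in_skew la mu i j]/(in_skewZ la mu i j) shape.
  by case Ei: (_ - a)%R => [m|m] //; case Ej: (_ - b)%R => [n|n] //= ->; split=> //; lia.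
have ofD i j : in_skew nu [::] i j ->
    [/\ in_skew la mu (absz (Posz i + a)%R) (absz (Posz j + b)%R),
        absz (Posz (absz (Posz i + a)%R) - a)%R = i
      & absz (Posz (absz (Posz j + b)%R) - b)%R = j].
  move=> c_in; have := shape (Posz i + a)%R (Posz j + b)%R.
  rewrite !GRing.addrK /= c_in.
  by case Ei: (_ + a)%R => [m|m] //; case Ej: (_ + b)%R => [n|n] //= ->; split=> //; lia.
apply/eqP; rewrite eqn_leq; apply/andP; split.
  apply: (coef_le_shift la_part nu_part ofD toD).
    by move=> i i' j /ofD[_ Ei _] /ofD[_ Ei' _]; lia.
  by move=> i j j' /ofD[_ _ Ej] /ofD[_ _ Ej']; lia.
apply: (coef_le_shift nu_part la_part toD ofD).
  by move=> i i' j /toD[_ Ei _] /toD[_ Ei' _]; lia.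
by move=> i j j' /toD[_ _ Ej] /toD[_ _ Ej']; lia.
Qed.

(** The half turn is its own inverse and yields inequalities with reversed contents; [coef_rev] for
    [nu] removes the reversal. *)
Lemma rot_shape_schur_eq la mu nu : is_partition la -> is_partition nu ->
  skew_eq_rot_shape la mu nu -> skew_schur_eq la mu nu [::].
Proof.
move=> la_part nu_part [a [b shape]] c.
have toD i j : in_skew la mu i j ->
    [/\ in_skew nu [::] (absz (a - Posz i)%R) (absz (b - Posz j)%R),
        absz (a - Posz (absz (a - Posz i)%R))%R = i
      & absz (b - Posz (absz (b - Posz j)%R))%R = j].
  rewrite -[in_skew la mu i j]/(in_skewZ la mu i j) shape.
  by case Ei: (a - _)%R => [m|m] //; case Ej: (b - _)%R => [n|n] //= ->; split=> //; lia.
have ofD i j : in_skew nu [::] i j ->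
    [/\ in_skew la mu (absz (a - Posz i)%R) (absz (b - Posz j)%R),
        absz (a - Posz (absz (a - Posz i)%R))%R = i
      & absz (b - Posz (absz (b - Posz j)%R))%R = j].
  move=> c_in; have := shape (a - Posz i)%R (b - Posz j)%R.
  rewrite !GRing.subKr /= c_in.
  by case Ei: (a - _)%R => [m|m] //; case Ej: (b - _)%R => [n|n] //= ->; split=> //; lia.
(* Below [a] and [b] the map [absz (a - _)] is genuine subtraction and so reverses order. *)
have le_ab i j : in_skew la mu i j || in_skew nu [::] i j -> ((Posz i <= a) && (Posz j <= b))%R.
  case/orP=> c_in; [have := shape i j|have := shape (a - Posz i)%R (b - Posz j)%R];
    rewrite ?GRing.subKr /= c_in.
    by case Ei: (a - _)%R => [m|m] //; case Ej: (b - _)%R => [n|n] //= _; lia.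
  by case Ei: (a - _)%R => [m|m] //; case Ej: (b - _)%R => [n|n] //= _; lia.
have absz_anti i i' j j' : in_skew la mu i j || in_skew nu [::] i j ->
    in_skew la mu i' j' || in_skew nu [::] i' j' ->
    (i < i' -> absz (a - Posz i')%R < absz (a - Posz i)%R) /\
    (j < j' -> absz (b - Posz j')%R < absz (b - Posz j)%R).
  by move=> /le_ab ? /le_ab ?; lia.
apply/eqP; rewrite eqn_leq; apply/andP; split.
  rewrite -[X in _ <= X](coef_rev nu_part); apply: (coef_le_rotate la_part nu_part ofD toD).
    by move=> i i' j H H'; apply: (absz_anti i i' j j _ _).1; rewrite ?H ?H' orbT.
  by move=> i j j' H H'; apply: (absz_anti i i j j' _ _).2; rewrite ?H ?H' orbT.
rewrite -(coef_rev nu_part) -{2}(revK c); apply: (coef_le_rotate nu_part la_part toD ofD).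
  by move=> i i' j H H'; apply: (absz_anti i i' j j _ _).1; rewrite ?H ?H'.
by move=> i j j' H H'; apply: (absz_anti i i j j' _ _).2; rewrite ?H ?H'.
Qed.

Theorem theorem2p1 (la mu nu : seq nat) :
  is_partition la -> is_partition mu -> is_partition nu ->
  (forall i, nth 0 mu i <= nth 0 la i) ->
  skew_connected la mu ->
  (skew_schur_eq la mu nu [::] <->
     skew_eq_shape la mu nu \/ skew_eq_rot_shape la mu nu).
Proof.
move=> la_part mu_part nu_part mu_sub connected; split.
  by move=> eq_schur; apply: schur_eq_shape.
by case; [apply: shape_schur_eq|apply: rot_shape_schur_eq].
Qed.
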